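(* Let $k$ be an ordinary differential field of characteristic zero, $R=k\{y_1,\ldots,y_l\}$, and let $P\subsetneq R$ be a prime differential ideal of order $h$. Let $>$ be an arbitrary ranking. Then there exists a (Kolchin) characteristic set $\mathbb{C}=C_1,\ldots,C_n$ of $P$ with respect to $>$ such that $\operatorname{ord}(C_i,y_t)\le h$ for all $1\le i\le n$ and all $1\le t\le l$.
   Context: $k$ is a differential field of characteristic zero with one derivation $\delta$; $R=k\{y_1,\dots,y_l\}$ is the polynomial ring over $k$ in the derivatives $y_j^{(r)}=\delta^r y_j$; the order of $y_j^{(r)}$ is $r$. For $f\in R$, $\operatorname{ord}f$ is the maximal order of a derivative appearing in $f$ and $\operatorname{ord}(f,y_t)$ is the maximal order of a derivative of $y_t$ appearing in $f$. A ranking is a total order on the derivatives with $\theta u\ge u$ and $u\ge v\Rightarrow \theta u\ge\theta v$ for derivative operators $\theta$; it is orderly if $\operatorname{ord}u>\operatorname{ord}v$ implies $u>v$. For $f\notin k$: leader $u_f$ = highest ranked derivative in $f$; initial $I_f$ = leading coefficient of $f$ in $u_f$. $f$ is reduced w.r.t. $g$ if no proper derivative of $u_g$ appears in $f$ and $\deg_{u_g}f<\deg_{u_g}g$. An autoreduced set is a set disjoint from $k$ each of whose elements is reduced w.r.t. the others; elements are listed in increasing rank ($f<g$ if $u_f<u_g$, or same leader and smaller degree), and autoreduced sets are compared lexicographically, a proper extension having lower rank. A (Kolchin) characteristic set of a differential ideal is an autoreduced subset of it of lowest rank. For an autoreduced set $\mathbb{A}=A_1,\dots,A_p$, $\operatorname{ord}\mathbb{A}=\sum_i\operatorname{ord}A_i$.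 The order of a prime differential ideal $P$ is $\operatorname{ord}\mathbb{C}$ for a characteristic set $\mathbb{C}$ of $P$ w.r.t. an orderly ranking. *)

(* Defs.v *)
From HB Require Import structures.
From mathcomp Require Import all_boot all_order all_algebra.
From mathcomp Require Import finmap.
From mathcomp Require Import monalg.

Set Implicit Arguments.
Unset Strict Implicit.
Unset Printing Implicit Defensive.

Import Order.TTheory GRing.Theory Num.Theory.
Local Open Scope ring_scope.


(* A derivative y_j^(r) is encoded as the pair (j, r), j : 'I_l, r : nat. *)
Definition dvar (l : nat) := ('I_l * nat)%type.

(* The differential polynomial ring k{y_1,...,y_l}: the polynomial ring over k
   in the (infinitely many) indeterminates y_j^(r). *)
Definition dpoly (k : fieldType) (l : nat) := {malg k[{cmonom (dvar l)}]}.

Definition is_derivation (k : fieldType) (d : k -> k) :=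
  (forall a b, d (a + b) = d a + d b) /\ (forall a b, d (a * b) = d a * b + a * d b).

(* The derivation delta on k{y}: extends d on coefficients and sends
   y_j^(r) to y_j^(r+1). *)
Definition dmon (k : fieldType) (l : nat) (m : cmonom (dvar l)) : dpoly k l :=
  \sum_(v <- finsupp m) << (m v)%:R *g mulcm (divcm m (ucm v)) (ucm (v.1, v.2.+1)) >>.

Definition dder (k : fieldType) (l : nat) (d : k -> k) (p : dpoly k l) : dpoly k l :=
  \sum_(m <- msupp p) (<< d p@_m *g m >> + p@_m *: dmon k m).

Definition dvars (k : fieldType) (l : nat) (f : dpoly k l) : {fset dvar l} :=
  (\bigcup_(m <- msupp f) finsupp m)%fset.

Definition is_const (k : fieldType) (l : nat) (f : dpoly k l) := dvars f = fset0%fset.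

Definition ddeg (k : fieldType) (l : nat) (u : dvar l) (f : dpoly k l) : nat :=
  (\max_(m <- msupp f) m u)%N.

Definition dord (k : fieldType) (l : nat) (f : dpoly k l) : nat :=
  (\max_(v <- dvars f) v.2)%N.
Definition dord_in (k : fieldType) (l : nat) (f : dpoly k l) (t : 'I_l) : nat :=
  (\max_(v <- dvars f | v.1 == t) v.2)%N.

Definition is_ideal (k : fieldType) (l : nat) (P : dpoly k l -> Prop) :=
  P 0 /\ (forall a b, P a -> P b -> P (a + b)) /\ (forall r a, P a -> P (r * a)).
Definition is_prime_diff_ideal (k : fieldType) (l : nat) (d : k -> k)
    (P : dpoly k l -> Prop) :=
  [/\ is_ideal P,
      (forall a b, P (a * b) -> P a \/ P b),
      (forall a, P a -> P (dder d a)) &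
      ~ P 1].

(* rankings: rk u v means u <= v *)
Definition is_ranking (l : nat) (rk : rel (dvar l)) :=
  [/\ (forall u, rk u u) /\ (forall u v, rk u v -> rk v u -> u = v),
      (forall u v w, rk u v -> rk v w -> rk u w),
      (forall u v, rk u v || rk v u),
      (forall (u : dvar l) s, rk u (u.1, u.2 + s)%N) &
      (forall (u v : dvar l) s, rk v u -> rk (v.1, v.2 + s)%N (u.1, u.2 + s)%N)].

Definition is_orderly (l : nat) (rk : rel (dvar l)) :=
  forall u v : dvar l, (v.2 < u.2)%N -> rk v u /\ u <> v.

Definition is_leader (k : fieldType) (l : nat) (rk : rel (dvar l)) (f : dpoly k l)
    (u : dvar l) :=
  u \in dvars f /\ forall v, v \in dvars f -> rk v u.

Definition is_reduced (k : fieldType) (l : nat) (rk : rel (dvar l)) (f g : dpoly k l) :=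
  forall u, is_leader rk g u ->
    (forall s, (0 < s)%N -> (u.1, u.2 + s)%N \notin dvars f) /\
    (ddeg u f < ddeg u g)%N.

Definition poly_lt (k : fieldType) (l : nat) (rk : rel (dvar l)) (f g : dpoly k l) :=
  exists uf ug, [/\ is_leader rk f uf, is_leader rk g ug &
    ((uf <> ug /\ rk uf ug) \/ (uf = ug /\ (ddeg uf f < ddeg ug g)%N))].
Definition poly_eqrank (k : fieldType) (l : nat) (rk : rel (dvar l)) (f g : dpoly k l) :=
  exists u, [/\ is_leader rk f u, is_leader rk g u & ddeg u f = ddeg u g].

Definition is_autoreduced (k : fieldType) (l : nat) (rk : rel (dvar l))
    (A : seq (dpoly k l)) :=
  [/\ (forall a, a \in A -> ~ is_const a),
      (forall i j, (i < size A)%N -> (j < size A)%N -> i <> j ->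
         is_reduced rk (nth 0 A i) (nth 0 A j)) &
      (forall i j, (i < j)%N -> (j < size A)%N -> poly_lt rk (nth 0 A i) (nth 0 A j))].

Definition aset_lt (k : fieldType) (l : nat) (rk : rel (dvar l)) (A B : seq (dpoly k l)) :=
  (exists i, [/\ (i < size A)%N, (i < size B)%N,
     (forall j, (j < i)%N -> poly_eqrank rk (nth 0 A j) (nth 0 B j)) &
     poly_lt rk (nth 0 A i) (nth 0 B i)]) \/
  ((size B < size A)%N /\
     forall j, (j < size B)%N -> poly_eqrank rk (nth 0 A j) (nth 0 B j)).

Definition is_char_set (k : fieldType) (l : nat) (rk : rel (dvar l))
    (P : dpoly k l -> Prop) (C : seq (dpoly k l)) :=
  [/\ is_autoreduced rk C, (forall c, c \in C -> P c) &
      forall B, is_autoreduced rk B -> (forall b, b \in B -> P b) -> ~ aset_lt rk B C].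

Definition aset_ord (k : fieldType) (l : nat) (A : seq (dpoly k l)) : nat :=
  (\sum_(a <- A) dord a)%N.

Definition has_order (k : fieldType) (l : nat) (P : dpoly k l -> Prop) (h : nat) :=
  exists rk : rel (dvar l), [/\ is_ranking rk, is_orderly rk &
    exists C, is_char_set rk P C /\ aset_ord C = h].

(* Main.v *)
(* Modulo the prime ideal P, algebraic dependence is expressed by derivations:
   v is algebraic over Y when every k-derivation that preserves P on finitely
   many elements of P and kills Y modulo P also kills v modulo P.  In
   characteristic zero this is the usual dependence, and linear algebra over
   the domain R/P yields the exchange inequality without fraction fields.

   For a ranking, call v principal when some f in P has leader v and separant
   outside P.  The principal derivatives are { y_i^(r) : i in J, r >= rho_i },
   and the others (the parametric ones) form a transcendence basis of R/P.
   For each i in J a relation F_i in P of least total degree expresses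
   y_i^(rho_i) over the parametric derivatives below it.  Counting transcendence
   degrees in bounded order against an orderly ranking, whose corners rho'
   satisfy sum rho' <= h, gives |J| = |J'| and sum rho <= h.  If F_j has the
   greatest order w in a parametric y_t among all the F_i, then y_t can be
   exchanged for y_j: the derivatives of order < w of y_t, those of order
   < rho_i of y_i for i in J other than j, and all derivatives of the remaining
   indeterminates, are independent as well, and the same count gives w <= h.

   The characteristic set is chosen with leaders y_i^(rho_i), each element being
   minimal for the degree in its leader, then for the total degree.  If some w
   of order > h occurred in an element s, then w would be parametric and absent
   from every F_i, so its partial derivative ds/dw would lie in P, contradicting
   the minimality of s. *)

Require Import Defs.
From HB Require Import structures.
From Stdlib Require Import Classical.
From mathcomp Require Import all_boot all_order all_algebra.
From mathcomp Require Import finmap.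
From mathcomp Require Import monalg.
From mathcomp Require Import zify ring.

Set Implicit Arguments.
Unset Strict Implicit.
Unset Printing Implicit Defensive.

Import Order.TTheory GRing.Theory Num.Theory.
Local Open Scope ring_scope.

(* An abstract interface to [{malg k[{cmonom I}]}]: comparing two distinct
   products of [malg] elements by conversion unfolds finite supports and does
   not terminate in practice, so the algebra is done over this record. *)
Record monomialRing (k : fieldType) (I : choiceType) := MonomialRing {
  mring :> comNzRingType;
  mono : k -> cmonom I -> mring;
  mcoef : mring -> cmonom I -> k;
  supp : mring -> {fset cmonom I};
  mcoefP : forall f g, (forall m, mcoef f m = mcoef g m) -> f = g;
  mcoefD : forall f g m, mcoef (f + g) m = mcoef f m + mcoef g m;
  mcoefU : forall c m m', mcoef (mono c m) m' = if m == m' then c else 0;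
  suppE : forall f m, (m \in supp f) = (mcoef f m != 0);
  monoE : forall f, f = \sum_(m <- supp f) mono (mcoef f m) m;
  monoM : forall c c' m m', mono c m * mono c' m' = mono (c * c') (mulcm m m');
  mono1 : mono 1 (onecm I) = 1
}.

(** * Derivations of a polynomial ring *)

Section Derivations.

Context {k : fieldType} {I : choiceType} {A : monomialRing k I}.
Implicit Types (f g : A) (m : cmonom I) (u v : I) (a b : I -> A) (c : k) (e : k -> k).

Lemma monoD c c' m : mono A (c + c') m = mono A c m + mono A c' m.
Proof.
by apply: mcoefP => m'; rewrite mcoefD !mcoefU; case: ifP; rewrite ?addr0.
Qed.

Lemma mono0 m : mono A 0 m = 0.
Proof. by apply: (@addrI _ (mono A 0 m)); rewrite -monoD !addr0. Qed.

Lemma mcoef0 m : mcoef (0 : A) m = 0.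
Proof. by rewrite -(mono0 m) mcoefU eqxx. Qed.

Lemma mcoef_outside f m : m \notin supp f -> mcoef f m = 0.
Proof. by rewrite suppE negbK => /eqP. Qed.

Definition mconst c : A := mono A c (onecm I).
Definition mvar v : A := mono A 1 (ucm v).

Lemma mconstD c c' : mconst (c + c') = mconst c + mconst c'.
Proof. exact: monoD. Qed.

Lemma mconst0 : mconst 0 = 0.
Proof. exact: mono0. Qed.

Lemma mconst1 : mconst 1 = 1.
Proof. exact: mono1. Qed.

Lemma mconstM c c' : mconst (c * c') = mconst c * mconst c'.
Proof. by rewrite /mconst monoM mul0cm. Qed.

Lemma mconst_nat n : mconst n%:R = n%:R.
Proof. by elim: n => [|n IH]; [exact: mconst0|rewrite -!natr1 mconstD IH mconst1]. Qed.

Lemma mul_mconst c c' m : mconst c * mono A c' m = mono A (c * c') m.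
Proof. by rewrite /mconst monoM mul0cm. Qed.

Lemma mono_split c m : mono A c m = mconst c * mono A 1 m.
Proof. by rewrite mul_mconst mulr1. Qed.

Lemma monomialRing_ind (Q : A -> Prop) :
  (forall c m, Q (mono A c m)) -> (forall f g, Q f -> Q g -> Q (f + g)) ->
  forall f, Q f.
Proof.
move=> QU QD f; rewrite (monoE f).
by elim/big_ind: _ => [|x y|m _]; [rewrite -(mono0 (onecm I))| exact: QD |].
Qed.

Definition dermon a m : A :=
  \sum_(v <- finsupp m) (m v)%:R * (mono A 1 (divcm m (ucm v)) * a v).

(** The derivation that is [e] on coefficients and takes the value [a v] at each indeterminate [v].
    Both [D] and [delta] are instances of it. *)
Definition der e a f : A :=
  \sum_(m <- supp f) (mono A (e (mcoef f m)) m + mconst (mcoef f m) * dermon a m).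

Lemma dermonEw a m (B : {fset I}) : (finsupp m `<=` B)%fset ->
  dermon a m = \sum_(v <- B) (m v)%:R * (mono A 1 (divcm m (ucm v)) * a v).
Proof.
by move=> sB; rewrite /dermon (big_fset_incl _ sB) // => v _;
  rewrite -cmE_eq0 => /eqP ->; rewrite mul0r.
Qed.

Lemma divcm_mull m m' v : m v != 0%N ->
  divcm (mulcm m m') (ucm v) = mulcm m' (divcm m (ucm v)).
Proof.
move=> nz; apply/eqP/cmP => u; rewrite divcmE !mulcmE divcmE ucmE.
by move: nz; case: (v =P u) => [->|_] /=; lia.
Qed.

Lemma dermonM a m m' :
  dermon a (mulcm m m') = mono A 1 m * dermon a m' + mono A 1 m' * dermon a m.
Proof.
have key m1 m2 v : (m1 v)%:R * (mono A 1 (divcm (mulcm m1 m2) (ucm v)) * a v)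
  = mono A 1 m2 * ((m1 v)%:R * (mono A 1 (divcm m1 (ucm v)) * a v)).
  have [->|nz] := eqVneq (m1 v) 0%N; first by rewrite !mul0r mulr0.
  by rewrite divcm_mull // -[X in mono A X _](mulr1 1) -monoM; ring.
rewrite (@dermonEw _ (mulcm m m') (finsupp m `|` finsupp m')%fset); last first.
  by rewrite -mdomD fsubset_refl.
rewrite (dermonEw a (fsubsetUl (finsupp m) (finsupp m'))).
rewrite (dermonEw a (fsubsetUr (finsupp m) (finsupp m'))).
rewrite !big_distrr /= -big_split /=; apply: eq_bigr => v _.
rewrite -!key mulcmE natrD mulrDl addrC; congr (_ + _).
by rewrite mulcmC.
Qed.

Lemma dermon1 a : dermon a (onecm I) = 0.
Proof. by rewrite /dermon mdom1 big_seq_fset0. Qed.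

Lemma dermonU a v : dermon a (ucm v) = a v.
Proof.
rewrite /dermon mdomU big_seq_fset1 ucmE eqxx.
have -> : divcm (ucm v) (ucm v) = onecm I.
  by apply/eqP/cmP => u; rewrite divcmE subnn cm1.
by rewrite mono1 !mul1r.
Qed.

Section Coef.

Context (e : k -> k) (eder : is_derivation e).

Let eD c c' : e (c + c') = e c + e c'. Proof. exact: eder.1. Qed.
Let eM c c' : e (c * c') = e c * c' + c * e c'. Proof. exact: eder.2. Qed.

Let e0 : e 0 = 0.
Proof. by apply: (@addrI _ (e 0)); rewrite -eD !addr0. Qed.

Let e1 : e 1 = 0.
Proof. by apply: (@addrI _ (e 1)); rewrite addr0 -[RHS]/(e 1) -{3}(mulr1 1) eM mulr1 mul1r. Qed.

Lemma derEw a f (B : {fset cmonom I}) : (supp f `<=` B)%fset ->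
  der e a f = \sum_(m <- B) (mono A (e (mcoef f m)) m + mconst (mcoef f m) * dermon a m).
Proof.
move=> sB; rewrite /der (big_fset_incl _ sB) // => m _ /mcoef_outside ->.
by rewrite e0 mono0 mconst0 mul0r addr0.
Qed.

Lemma derD a f g : der e a (f + g) = der e a f + der e a g.
Proof.
have sD : (supp (f + g) `<=` supp f `|` supp g)%fset.
  apply/fsubsetP => m; rewrite in_fsetU !suppE mcoefD.
  by case: (eqVneq (mcoef f m) 0) => [->|//]; rewrite add0r.
rewrite (derEw a sD) (derEw a (fsubsetUl (supp f) (supp g))).
rewrite (derEw a (fsubsetUr (supp f) (supp g))) -big_split.
by apply: eq_bigr => m _ /=; rewrite mcoefD eD monoD mconstD; ring.
Qed.

Lemma derU a c m : der e a (mono A c m) = mono A (e c) m + mconst c * dermon a m.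
Proof.
have sU : (supp (mono A c m) `<=` [fset m])%fset.
  by apply/fsubsetP => m'; rewrite in_fset1 suppE mcoefU [m' == m]eq_sym; case: ifP; rewrite ?eqxx.
by rewrite (derEw a sU) big_seq_fset1 mcoefU eqxx.
Qed.

Lemma derC a c : der e a (mconst c) = mconst (e c).
Proof. by rewrite derU dermon1 mulr0 addr0. Qed.

Lemma der0 a : der e a 0 = 0.
Proof. by rewrite -mconst0 derC e0. Qed.

Lemma derX a v : der e a (mvar v) = a v.
Proof. by rewrite derU dermonU e1 mono0 mconst1 mul1r add0r. Qed.

Lemma derM a f g : der e a (f * g) = der e a f * g + f * der e a g.
Proof.
elim/monomialRing_ind: f g => [c m|f1 f2 IH1 IH2] g; last first.
  by rewrite mulrDl !derD IH1 IH2; ring.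
elim/monomialRing_ind: g => [c' m'|g1 g2 IH1 IH2]; last first.
  by rewrite mulrDr !derD IH1 IH2; ring.
rewrite monoM !derU eM dermonM monoD mconstM -!monoM.
rewrite (mono_split c m) (mono_split c' m'); ring.
Qed.

Lemma derN a f : der e a (- f) = - der e a f.
Proof. by apply: (@addrI _ (der e a f)); rewrite -derD !subrr der0. Qed.

End Coef.

End Derivations.

(** * Occurring variables, degrees and partial derivatives *)

Section Variables.

Context {k : fieldType} {I : choiceType} {A : monomialRing k I}.
Implicit Types (f g : A) (m : cmonom I) (u v w : I)
  (a b : I -> A) (c : k) (W : I -> Prop).

Definition mvars f : {fset I} := (\bigcup_(m <- supp f) finsupp m)%fset.
Definition mdegin u f : nat := (\max_(m <- supp f) m u)%N.
(** The shift by one separates [0], of degree [0], from the nonzero constants, of degree [1], so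
    that a partial derivative lowers [tdeg] on every nonzero polynomial. *)
Definition tdeg f : nat := (\max_(m <- supp f) (mdeg m).+1)%N.

Lemma mvarsP f v : reflect (exists2 m, mcoef f m != 0 & m v != 0%N) (v \in mvars f).
Proof.
apply: (iffP (bigfcupP _ _ _ _)).
  by case=> m; rewrite andbT -cmE_neq0 suppE => ? ?; exists m.
by case=> m ? ?; exists m; rewrite ?andbT ?suppE // -cmE_neq0.
Qed.

Lemma leq_mdegin u f m : mcoef f m != 0 -> (m u <= mdegin u f)%N.
Proof.
by rewrite -suppE => mf; exact: (@leq_bigmax_seq _ _ xpredT (fun m => m u) m).
Qed.

Lemma mdegin_leq u f n : (forall m, mcoef f m != 0 -> (m u <= n)%N) -> (mdegin u f <= n)%N.
Proof. by move=> H; apply/bigmax_leqP_seq => m; rewrite suppE => /H. Qed.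

Lemma ltn_tdeg f m : mcoef f m != 0 -> (mdeg m < tdeg f)%N.
Proof.
by rewrite -suppE => mf; exact: (@leq_bigmax_seq _ _ xpredT (fun m => (mdeg m).+1) m).
Qed.

Lemma tdeg_leq f n : (forall m, mcoef f m != 0 -> (mdeg m < n)%N) -> (tdeg f <= n)%N.
Proof. by move=> H; apply/bigmax_leqP_seq => m; rewrite suppE => /H. Qed.

Lemma mcoef_neq0 f : f != 0 -> exists m, mcoef f m != 0.
Proof.
move=> nz; apply: NNPP => H; case/eqP: nz; apply: mcoefP => m; rewrite mcoef0.
by apply/eqP/negPn/negP => ?; apply: H; exists m.
Qed.

Lemma tdeg_gt0 f : f != 0 -> (0 < tdeg f)%N.
Proof. by case/mcoef_neq0 => m /ltn_tdeg; apply: leq_ltn_trans. Qed.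

Lemma mdegin_eq0 u f : (mdegin u f == 0%N) = (u \notin mvars f).
Proof.
apply/idP/idP => [d0|uf].
  by apply/mvarsP => -[m /(leq_mdegin u)]; rewrite (eqP d0) leqn0 => ->.
rewrite -leqn0; apply: mdegin_leq => m mf; rewrite leqn0; apply: contraNT uf => ?.
by apply/mvarsP; exists m.
Qed.

Definition in_vars W f := forall v, v \in mvars f -> W v.

Lemma in_varsP W f :
  in_vars W f <-> (forall m v, mcoef f m != 0 -> m v != 0%N -> W v).
Proof.
split=> [fW m v mf mv|H v /mvarsP[m]]; last exact: H.
by apply: fW; apply/mvarsP; exists m.
Qed.

Lemma in_varsS W W' f : (forall v, W v -> W' v) -> in_vars W f -> in_vars W' f.
Proof. by move=> sW fW v /fW /sW. Qed.

Lemma in_varsD W f g : in_vars W f -> in_vars W g -> in_vars W (f + g).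
Proof.
move=> /in_varsP fW /in_varsP gW; apply/in_varsP => m v.
have [f0|fm _] := eqVneq (mcoef f m) 0; last exact: fW fm.
by rewrite mcoefD f0 add0r; apply: gW.
Qed.

Lemma in_varsU W c m : (forall v, m v != 0%N -> W v) -> in_vars W (mono A c m).
Proof.
move=> mW; apply/in_varsP => m' v; rewrite mcoefU.
by case: (m =P m') => [<- _|_]; [apply: mW | rewrite eqxx].
Qed.

Lemma in_varsC W c : in_vars W (mconst c : A).
Proof. by apply: in_varsU => v; rewrite onecmE. Qed.

Lemma in_vars0 W : in_vars W (0 : A).
Proof. by rewrite -mconst0; apply: in_varsC. Qed.

Lemma in_vars1 W : in_vars W (1 : A).
Proof. by rewrite -mconst1; apply: in_varsC. Qed.

Lemma in_varsX W v : W v -> in_vars W (mvar v : A).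
Proof. by move=> Wv; apply: in_varsU => u; rewrite ucmE; case: (v =P u) => // <-. Qed.

Lemma in_vars_sum W (J : eqType) (r : seq J) (F : J -> A) :
  (forall j, j \in r -> in_vars W (F j)) -> in_vars W (\sum_(j <- r) F j).
Proof.
elim: r => [|j r IH] H; rewrite ?big_nil ?big_cons; first exact: in_vars0.
apply: in_varsD; first by apply: H; rewrite mem_head.
by apply: IH => i ir; apply: H; rewrite in_cons ir orbT.
Qed.

Lemma in_varsM W f g : in_vars W f -> in_vars W g -> in_vars W (f * g).
Proof.
move=> /in_varsP fW /in_varsP gW; rewrite (monoE f) (monoE g) big_distrl /=.
apply: in_vars_sum => m; rewrite suppE => mf; rewrite big_distrr /=.
apply: in_vars_sum => m'; rewrite suppE => mg; rewrite monoM.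
apply: in_varsU => v; rewrite mulcmE addn_eq0 negb_and => /orP[]; by [apply: fW|apply: gW].
Qed.

Lemma in_varsN W f : in_vars W f -> in_vars W (- f).
Proof.
move=> /in_varsP fW; apply/in_varsP => m v fm; apply: fW.
apply: contraNneq fm => E; have := mcoefD f (- f) m.
by rewrite subrr mcoef0 E add0r => <-.
Qed.

Lemma in_varsB W f g : in_vars W f -> in_vars W g -> in_vars W (f - g).
Proof. by move=> fW gW; apply: in_varsD => //; apply: in_varsN. Qed.

(** Monomials are built by one indeterminate at a time, so that applications only meet the product
    rule for [mvar v * f]. *)
Lemma in_vars_ind W (Q : A -> Prop) :
  (forall c, Q (mconst c)) -> (forall f g, Q f -> Q g -> Q (f + g)) ->
  (forall v f, W v -> in_vars W f -> Q f -> Q (mvar v * f)) ->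
  forall f, in_vars W f -> Q f.
Proof.
move=> QC QD QX f /in_varsP fW.
have QU n m c : mdeg m = n -> (forall v, m v != 0%N -> W v) -> Q (mono A c m).
  elim: n m => [|n IH] m dm mW.
    by rewrite (mdeg_eq0I dm); apply: QC.
  have [v mv] : exists v, m v != 0%N.
    apply: NNPP => H; suff m1 : m = onecm I by rewrite m1 mdeg1 in dm.
    apply/eqP/cmP => v; rewrite onecmE; apply/eqP/negPn/negP => ?.
    by apply: H; exists v.
  have Em : m = mulcm (ucm v) (divcm m (ucm v)).
    apply/eqP/cmP => u; rewrite mulcmE divcmE ucmE.
    by move: mv; case: (v =P u) => [->|_] /=; lia.
  have mW' u : divcm m (ucm v) u != 0%N -> W u.
    by move=> H; apply: mW; apply: contraNneq H => E; rewrite divcmE E.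
  rewrite Em -[c]mul1r -monoM; apply: QX; [exact: mW | exact: in_varsU | apply: IH => //].
  by move: dm; rewrite {1}Em mdegM mdegU add1n => -[].
rewrite (monoE f) big_seq; elim/big_ind: _ => [|x y|m].
- by rewrite -mconst0.
- exact: QD.
- by rewrite suppE => mf; apply: QU => // v; apply: fW.
Qed.

Lemma in_vars_self f : in_vars (fun v => v \in mvars f) f.
Proof. by []. Qed.

Lemma mvars_eq0 f : mvars f = fset0 -> exists c, f = mconst c.
Proof.
move=> f0; have fW : in_vars (fun=> False) f by move=> v; rewrite f0.
elim/in_vars_ind: fW => [c|_ _ [c ->] [c' ->]|//]; first by exists c.
by exists (c + c'); rewrite mconstD.
Qed.

Lemma zero_derivation : is_derivation (fun=> 0 : k).
Proof. by split=> *; rewrite ?mul0r ?mulr0 addr0. Qed.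

(** A [k]-linear derivation, seen as a tangent vector with coordinates [a v]. *)
Definition D a f : A := der (fun=> 0) a f.
Definition pd v f : A := D (fun u => (u == v)%:R) f.

Lemma D_D a f g : D a (f + g) = D a f + D a g.
Proof. exact: (derD zero_derivation). Qed.
Lemma D_M a f g : D a (f * g) = D a f * g + f * D a g.
Proof. exact: (derM zero_derivation). Qed.
Lemma D_X a v : D a (mvar v) = a v.
Proof. exact: (derX zero_derivation). Qed.
Lemma D_C a c : D a (mconst c) = 0.
Proof. by rewrite /D (derC zero_derivation) mconst0. Qed.
Lemma D_N a f : D a (- f) = - D a f.
Proof. exact: (derN zero_derivation). Qed.
Lemma D_0 a : D a 0 = 0.
Proof. exact: (der0 zero_derivation). Qed.

Lemma pd_D v f g : pd v (f + g) = pd v f + pd v g.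
Proof. exact: D_D. Qed.
Lemma pd_M v f g : pd v (f * g) = pd v f * g + f * pd v g.
Proof. exact: D_M. Qed.
Lemma pd_X v u : pd v (mvar u) = (u == v)%:R.
Proof. exact: D_X. Qed.
Lemma pd_C v c : pd v (mconst c) = 0.
Proof. exact: D_C. Qed.

Lemma DE a f (B : {fset I}) : (mvars f `<=` B)%fset ->
  D a f = \sum_(v <- B) a v * pd v f.
Proof.
move=> /fsubsetP sB; have {}sB : in_vars (fun v => v \in B) f by [].
elim/in_vars_ind: sB => [c|f1 f2 IH1 IH2|u {}f uB _ IH].
- by rewrite D_C big1 // => v _; rewrite pd_C mulr0.
- rewrite D_D IH1 IH2 -big_split /=; apply: eq_bigr => v _.
  by rewrite pd_D mulrDr.
rewrite D_M D_X IH [in RHS](eq_bigr (fun v => (u == v)%:R * (a v * f) + mvar u * (a v * pd v f))).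
  rewrite big_split /= big_distrr /=; congr (_ + _).
  rewrite (big_fsetD1 u) //= eqxx mul1r big_seq_cond big1 ?addr0 // => v.
  by rewrite in_fsetD1 eq_sym => /andP[/andP[/negPf -> _] _]; rewrite mul0r.
by move=> v _; rewrite pd_M pd_X; ring.
Qed.

Lemma pd_notin v f : v \notin mvars f -> pd v f = 0.
Proof.
move=> vf; rewrite /pd (DE _ (fsubset_refl _)) big_seq big1 // => u uf.
by case: eqP uf vf => [->|_ _ _]; [move=> -> | rewrite mul0r].
Qed.

Lemma eq_D a b f : (forall v, v \in mvars f -> a v = b v) -> D a f = D b f.
Proof.
move=> ab; rewrite !(DE _ (fsubset_refl (mvars f))) !big_seq.
by apply: eq_bigr => v vf; rewrite ab.
Qed.

Lemma D_scale r a f : D (fun v => r * a v) f = r * D a f.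
Proof.
rewrite !(DE _ (fsubset_refl (mvars f))) big_distrr /=.
by apply: eq_bigr => v _; rewrite mulrA.
Qed.

Lemma D_sum (J : Type) (r : seq J) (F : J -> I -> A) f :
  D (fun v => \sum_(j <- r) F j v) f = \sum_(j <- r) D (F j) f.
Proof.
rewrite (DE _ (fsubset_refl (mvars f))).
under eq_bigr do rewrite big_distrl /=.
rewrite exchange_big /=; apply: eq_bigr => j _.
by rewrite (DE _ (fsubset_refl (mvars f))).
Qed.

Lemma D_split v a f :
  D a f = D (fun u => if u == v then 0 else a u) f + a v * pd v f.
Proof.
set B := (v |` mvars f)%fset.
have sB : (mvars f `<=` B)%fset by apply: fsubsetU1.
rewrite (DE a sB) (DE (fun u => if u == v then 0 else a u) sB).
rewrite !(big_fsetD1 v (fset1U1 _ _)) /= eqxx mul0r add0r addrC.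
congr (_ + _); rewrite !big_seq; apply: eq_bigr => u.
by rewrite in_fsetD1 => /andP[/negPf ->].
Qed.

Lemma mcoef_sum (J : Type) (r : seq J) (F : J -> A) m :
  mcoef (\sum_(j <- r) F j) m = \sum_(j <- r) mcoef (F j) m.
Proof.
by elim: r => [|j r IH]; rewrite ?big_nil ?mcoef0 // !big_cons mcoefD IH.
Qed.

(** The monomial [m] of the derivative arises only from [m] times [v], whose exponent at [v] is one
    larger. *)
Lemma mcoef_pd v f m : mcoef (pd v f) m = (m v).+1%:R * mcoef f (mulcm m (ucm v)).
Proof.
move: f; apply: monomialRing_ind => [c n|f g IH1 IH2]; last first.
  by rewrite pd_D !mcoefD IH1 IH2 mulrDr.
rewrite /pd /D (derU zero_derivation) mono0 add0r /dermon big_distrr /= mcoef_sum.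
have step w : mcoef (mconst c * ((n w)%:R * (mono A 1 (divcm n (ucm w)) * (w == v)%:R))) m
    = (w == v)%:R * (if n == mulcm m (ucm v) then (m v).+1%:R * c else 0).
  case: eqP => [->|_]; last by rewrite mulr0 !(mulr0, mul0r) mcoef0.
  rewrite mulr1 mul1r -mconst_nat !mul_mconst mulr1 mcoefU.
  have [n0|nv] := eqVneq (n v) 0%N.
    rewrite n0 mulr0n mulr0 if_same; case: (n =P _) => [E|//].
    by move: n0; rewrite E mulcmE ucmE eqxx addn1.
  have -> : (divcm n (ucm v) == m) = (n == mulcm m (ucm v)).
    apply/eqP/eqP => [<-|->]; apply/eqP/cmP => u; rewrite !(mulcmE, divcmE) ucmE.
      by move: nv; case: (v =P u) => [->|_] /=; lia.
    by rewrite addnK.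
  by case: eqP => [->|//]; rewrite mulcmE ucmE eqxx addn1 mulrC.
rewrite (eq_bigr _ (fun w _ => step w)) mcoefU.
rewrite -big_distrl /=; case: eqP => [->|_]; last by rewrite !mulr0.
rewrite (big_fsetD1 v) /=; last by rewrite -cmE_neq0 mulcmE ucmE eqxx addn1.
rewrite eqxx big_seq_cond big1 ?addr0 ?mul1r // => w.
by rewrite in_fsetD1 => /andP[/andP[/negPf -> _] _].
Qed.

Lemma mvars_pd v u f : u \in mvars (pd v f) -> u \in mvars f.
Proof.
move=> /mvarsP[m]; rewrite mcoef_pd => H mu; apply/mvarsP; exists (mulcm m (ucm v)).
  by apply: contraNneq H => ->; rewrite mulr0.
by rewrite mulcmE addn_eq0 negb_and mu.
Qed.

Lemma in_vars_pd W v f : in_vars W f -> in_vars W (pd v f).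
Proof. by move=> fW u /mvars_pd /fW. Qed.

Lemma mdegin_pd u v f : (mdegin u (pd v f) <= mdegin u f)%N.
Proof.
apply: mdegin_leq => m; rewrite mcoef_pd => H.
apply: (@leq_trans (mulcm m (ucm v) u)); first by rewrite mulcmE leq_addr.
by apply: leq_mdegin; apply: contraNneq H => ->; rewrite mulr0.
Qed.

Lemma tdeg_pd v f : f != 0 -> (tdeg (pd v f) < tdeg f)%N.
Proof.
move=> nz; rewrite -(prednK (tdeg_gt0 nz)) ltnS; apply: tdeg_leq => m; rewrite mcoef_pd => H.
suff : (mdeg m + 1 < tdeg f)%N by lia.
rewrite -(@mdegU _ v) -mdegM; apply: ltn_tdeg.
by apply: contraNneq H => E; rewrite E mulr0.
Qed.

Lemma pd_neq0 v f : [pchar k] =i pred0 -> v \in mvars f -> pd v f != 0.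
Proof.
move=> char0 /mvarsP[m fm mv]; apply/eqP => E.
have Em : m = mulcm (divcm m (ucm v)) (ucm v).
  apply/eqP/cmP => u; rewrite mulcmE divcmE ucmE.
  by move: mv; case: (v =P u) => [->|_] /=; lia.
move: (mcoef_pd v f (divcm m (ucm v))); rewrite E mcoef0 -Em => /esym/eqP.
by rewrite mulf_eq0 (negPf fm) orbF -[_ == 0]/(_ == _) (pcharf0P k).1.
Qed.

(* [mvar s] plays the role of the indeterminate of [{poly A}]. *)
Lemma in_vars_poly W s f : in_vars (fun v => W v \/ v = s) f ->
  exists2 p : {poly A}, (forall i, in_vars W p`_i) & f = p.[mvar s].
Proof.
move=> fW; elim/in_vars_ind: fW => [c|f1 f2 [p1 W1 ->] [p2 W2 ->]|v f1 Wv _ [p Wp ->]].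
- exists (mconst c)%:P; rewrite ?hornerC // => i; rewrite coefC.
  by case: eqP => _; [apply: in_varsC|apply: in_vars0].
- by exists (p1 + p2); rewrite ?hornerD // => i; rewrite coefD; apply: in_varsD.
case: Wv => [Wv|->].
  exists ((mvar v)%:P * p); rewrite ?hornerM ?hornerC // => i; rewrite coefCM.
  by apply: in_varsM => //; apply: in_varsX.
exists (p * 'X); last by rewrite hornerMX mulrC.
move=> i; rewrite coefMX.
by case: eqP => _; [apply: in_vars0|].
Qed.

Lemma pd_horner W s (p : {poly A}) : ~ W s -> (forall i, in_vars W p`_i) ->
  pd s p.[mvar s] = p^`().[mvar s].
Proof.
move=> Ws; elim/poly_ind: p => [|p c IH] Wp.
  by rewrite deriv0 horner0 pd_notin //; apply/negP => /(in_vars0 (fun=> False)).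
have Wc : in_vars W c.
  by move: (Wp 0%N); rewrite coefD coefMX coefC /= add0r.
have Wp' i : in_vars W p`_i.
  by move: (Wp i.+1); rewrite coefD coefMX coefC /= addr0.
rewrite derivD derivM derivX derivC addr0 mulr1 !hornerE pd_D pd_M pd_X eqxx IH //.
rewrite [pd s c]pd_notin; last by apply/negP => /Wc.
by rewrite addr0 mulr1.
Qed.

End Variables.

(** * Algebraic dependence modulo a prime ideal *)

Section Closure.

Lemma exists_min (T : Type) (Q : T -> Prop) (mu : T -> nat) :
  (exists x, Q x) -> exists2 x, Q x & forall y, Q y -> (mu x <= mu y)%N.
Proof.
case=> x Qx; have [n] := ubnP (mu x); elim: n => // n IH in x Qx *.
move=> le_xn; case: (classic (exists2 y, Q y & (mu y < mu x)%N)) => [[y Qy lt_yx]|H].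
  by apply: IH Qy _; apply: leq_trans lt_yx _.
by exists x => // y Qy; rewrite leqNgt; apply/negP => ?; apply: H; exists y.
Qed.

Definition prime_ideal (R : comNzRingType) (P : R -> Prop) :=
  [/\ P 0, forall a b, P a -> P b -> P (a + b), forall r a, P a -> P (r * a),
      forall a b, P (a * b) -> P a \/ P b & ~ P 1].

(** * Arithmetic and linear algebra modulo a prime ideal *)

Section PrimeIdeal.

Context {R : comNzRingType} {P : R -> Prop} (hP : prime_ideal P).
Implicit Types (a b r : R).

Lemma ideal0 : P 0. Proof. by case: hP. Qed.
Lemma idealD a b : P a -> P b -> P (a + b). Proof. by case: hP => _ + _ _ _; apply. Qed.
Lemma idealMl r a : P a -> P (r * a). Proof. by case: hP => _ _ + _ _; apply. Qed.
Lemma idealMr r a : P a -> P (a * r). Proof. by rewrite mulrC; apply: idealMl. Qed.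
Lemma idealN a : P a -> P (- a). Proof. by rewrite -mulN1r; apply: idealMl. Qed.
Lemma idealB a b : P a -> P b -> P (a - b). Proof. by move=> ? /idealN; apply: idealD. Qed.
Lemma primeM a b : ~ P a -> ~ P b -> ~ P (a * b).
Proof. by move=> na nb ab; case: hP => _ _ _ /(_ _ _ ab)[]. Qed.
Lemma primeMK a b : ~ P a -> P (a * b) -> P b.
Proof. by move=> na ab; apply: NNPP => nb; apply: primeM na nb ab. Qed.
Lemma idealDK a b : P a -> P (a + b) -> P b.
Proof. by move=> aP abP; rewrite -[b](addKr a); apply: idealD => //; apply: idealN. Qed.
Lemma ideal_sum (J : eqType) (s : seq J) (Q : pred J) (F : J -> R) :
  (forall j, j \in s -> Q j -> P (F j)) -> P (\sum_(j <- s | Q j) F j).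
Proof.
move=> H; rewrite big_seq_cond; elim/big_ind: _ => [|x y|j /andP[]].
- exact: ideal0.
- exact: idealD.
- exact: H.
Qed.

(** Gaussian elimination without division: a coefficient outside [P] is the pivot for the last
    equation, and primality keeps the rescaled solution nontrivial modulo [P]. *)
Lemma linear_dependence m n (B : 'I_n -> nat -> R) : (m < n)%N ->
  exists c : 'I_n -> R, (exists j, ~ P (c j)) /\
    forall i, (i < m)%N -> P (\sum_j c j * B j i).
Proof.
have P1 : ~ P 1 by case: hP.
elim: m n B => [|m IH] [//|n] B lt_mn.
  by exists (fun=> 1); split=> //; exists ord0.
case: (classic (forall j, P (B j m))) => [Bm|/not_all_ex_not[j0 Bj0]].
  have [c [cn c_eq]] := IH _ B (ltnW lt_mn).
  exists c; split=> // i; rewrite ltnS leq_eqVlt => /orP[/eqP ->|]; last exact: c_eq.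
  by apply: ideal_sum => j _ _; apply: idealMl.
have [c [[j cj] c_eq]] :=
  IH _ (fun j i => B j0 m * B (lift j0 j) i - B (lift j0 j) m * B j0 i) lt_mn.
pose c' i := if unlift j0 i is Some j then B j0 m * c j
             else - \sum_j c j * B (lift j0 j) m.
exists c'; split.
  by exists (lift j0 j); rewrite /c' liftK; apply: primeM.
have E i : \sum_j c' j * B j i =
    \sum_j c j * (B j0 m * B (lift j0 j) i - B (lift j0 j) m * B j0 i).
  rewrite (bigD1_ord j0) //= /c' unlift_none mulNr big_distrl /= -sumrN -big_split /=.
  by apply: eq_bigr => u _; rewrite liftK; ring.
move=> i; rewrite E ltnS leq_eqVlt => /orP[/eqP ->|]; last exact: c_eq.
by rewrite big1 => [|u _]; [exact: ideal0|ring].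
Qed.

End PrimeIdeal.

(** * Algebraic closure and independence modulo [P] *)

Context {k : fieldType} {I : choiceType} {A : monomialRing k I}.
Context (char0 : [pchar k] =i pred0).
Context {P : A -> Prop} (hP : prime_ideal P).
Implicit Types (f g : A) (u v w : I) (a b : I -> A) (X Y Z W : I -> Prop).

Lemma ideal_mconst c : P (mconst c) -> c = 0.
Proof.
move=> Pc; apply/eqP; case: (eqVneq c 0) => // nz.
case: hP => _ _ PM _ []; move: (PM (mconst c^-1) _ Pc).
by rewrite -mconstM mulVf // mconst1.
Qed.

Lemma ideal_natr n : P n.+1%:R -> False.
Proof.
rewrite -mconst_nat => /ideal_mconst/eqP.
by rewrite (pcharf0P k).1.
Qed.

(** The finite list [T] is a certificate: certificates can be concatenated, and a derivation
    refuting one has to respect [P] only in finitely many variables. *)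
Definition cl Y v := exists2 T : seq A, (forall f, f \in T -> P f) &
  forall a, (forall f, f \in T -> P (D a f)) -> (forall y, Y y -> P (a y)) -> P (a v).

Definition indep X := forall f, in_vars X f -> P f -> f = 0.

Lemma cl_sub Y v : Y v -> cl Y v.
Proof. by move=> Yv; exists [::] => // a _; apply. Qed.

Lemma clS Y Z v : (forall y, Y y -> Z y) -> cl Y v -> cl Z v.
Proof. by move=> sYZ [T PT HT]; exists T => // a aT aZ; apply: HT => // y /sYZ /aZ. Qed.

Lemma cl_seq Y (s : seq I) : (forall u, u \in s -> cl Y u) ->
  exists2 T : seq A, (forall f, f \in T -> P f) &
  forall a, (forall f, f \in T -> P (D a f)) -> (forall y, Y y -> P (a y)) ->
    forall u, u \in s -> P (a u).
Proof.
elim: s => [|v s IH] clY; first by exists [::].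
have [u us|T PT HT] := IH; first by apply: clY; rewrite in_cons us orbT.
have [T' PT' HT'] := clY v (mem_head _ _).
exists (T' ++ T) => [f|a aT aY u].
  by rewrite mem_cat => /orP[/PT'|/PT].
rewrite in_cons => /orP[/eqP ->|us].
  by apply: HT' => // f fT; apply: aT; rewrite mem_cat fT.
by apply: HT => // f fT; apply: aT; rewrite mem_cat fT orbT.
Qed.

Lemma cl_trans (s : seq I) Z v :
  (forall u, u \in s -> cl Z u) -> cl (fun u => u \in s) v -> cl Z v.
Proof.
move=> /cl_seq[T PT HT] [T' PT' HT']; exists (T' ++ T) => [f|a aT aZ].
  by rewrite mem_cat => /orP[/PT'|/PT].
apply: HT' => [f fT|u us]; first by apply: aT; rewrite mem_cat fT.
by apply: HT us => // f fT; apply: aT; rewrite mem_cat fT orbT.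
Qed.

Lemma ideal_D a f : (forall u, u \in mvars f -> P (a u)) -> P (D a f).
Proof.
move=> aP; rewrite (DE _ (fsubset_refl _)); apply: (ideal_sum hP) => u uf _.
by apply: (idealMr hP); apply: aP.
Qed.

Lemma ideal_D_pd a v f : (forall u, u \in mvars f -> u != v -> P (a u)) ->
  P (D a f) -> P (a v * pd v f).
Proof.
move=> aP; rewrite (D_split v); apply: (idealDK hP); apply: ideal_D => u uf.
by case: eqP => [_|/eqP uv]; [apply: (ideal0 hP)|apply: aP].
Qed.

(** [D a f] is the sum of the [a u * pd u f]. All terms but the one at [v] lie in [P], and the
    factor [pd v f] is cancelled by primality. *)
Lemma cl_step Z v f : P f -> ~ P (pd v f) ->
  (forall u, u \in mvars f -> u != v -> cl Z u) -> cl Z v.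
Proof.
move=> Pf nPf clZ.
have [u|T PT HT] := @cl_seq Z (enum_fset (mvars f `\ v)%fset).
  by rewrite in_fsetD1 => /andP[uv uf]; apply: clZ.
exists (f :: T) => [g|a aT aZ]; first by rewrite in_cons => /orP[/eqP ->|/PT].
apply: (primeMK hP nPf); rewrite mulrC; apply: ideal_D_pd; last exact/aT/mem_head.
move=> u uf uv; apply: HT => //; last by rewrite in_fsetD1 uv.
by move=> g gT; apply: aT; rewrite in_cons gT orbT.
Qed.

(** * Extension of a derivation to one more indeterminate *)

Section Extension.

Context (W : I -> Prop) (s : I) (a : I -> A).
Hypothesis Ws : ~ W s.
Hypothesis aW : forall f, in_vars W f -> P f -> P (D a f).

Let coefs (p : {poly A}) := forall i, in_vars W p`_i.

Let step_down (b : I -> A) (p : {poly A}) :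
  (forall f, in_vars W f -> P f -> P (D b f)) ->
  coefs p -> P (lead_coef p) ->
  P p.[mvar s] -> p != 0 ->
  exists2 q : {poly A}, [/\ coefs q, P q.[mvar s] & (size q < size p)%N] &
    (P (D b q.[mvar s]) -> P (D b p.[mvar s])).
Proof.
move=> bW Wp Pl Pp nz.
pose t : {poly A} := lead_coef p *: 'X^((size p).-1).
have Et : t.[mvar s] = lead_coef p * mvar s ^+ (size p).-1 by rewrite !hornerE.
have Pt : P t.[mvar s] by rewrite Et; apply: (idealMr hP).
have PDt : P (D b t.[mvar s]).
  rewrite Et D_M; apply: (idealD hP); apply: (idealMr hP) => //.
  by apply: bW => //; apply: Wp.
exists (p - t).
  split.
  - move=> i; rewrite coefB coefZ coefXn; apply: in_varsB => //.
    apply: in_varsM; first exact: Wp.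
    by case: (_ == _); [apply: in_vars1|apply: in_vars0].
  - by rewrite hornerD hornerN; apply: (idealB hP).
  - have sz : size p = (size p).-1.+1 by rewrite prednK // size_poly_gt0.
    rewrite [X in (_ < X)%N]sz ltnS; apply/leq_sizeP => j le_j.
    rewrite coefB coefZ coefXn; case: eqP => [->|/eqP ne]; first by rewrite mulr1 subrr.
    by rewrite mulr0 subr0 nth_default // sz ltn_neqAle eq_sym ne.
move=> Pq; rewrite -[p](subrK t) hornerD D_D; exact: (idealD hP).
Qed.

(** Pseudo-division by [p0]: the multiplier [lead_coef p0] lies outside [P] and can be cancelled
    afterwards. *)
Let step_div (b : I -> A) (p0 p : {poly A}) :
  P (D b p0.[mvar s]) -> coefs p0 -> ~ P (lead_coef p0) -> P p0.[mvar s] ->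
  coefs p -> P p.[mvar s] -> (size p0 <= size p)%N -> (0 < size p)%N ->
  exists2 q : {poly A}, [/\ coefs q, P q.[mvar s] & (size q < size p)%N] &
    (P (D b q.[mvar s]) -> P (D b p.[mvar s])).
Proof.
move=> PD0 W0 nP0 P0 Wp Pp le_sz p_gt0.
have p0_gt0 : (0 < size p0)%N.
  by rewrite size_poly_gt0; apply: contra_not_neq nP0 => ->; rewrite lead_coef0; apply: ideal0.
pose t : {poly A} := lead_coef p *: 'X^(size p - size p0).
pose q := (lead_coef p0)%:P * p - t * p0.
have Eq : q.[mvar s] = lead_coef p0 * p.[mvar s] - t.[mvar s] * p0.[mvar s].
  by rewrite /q hornerD hornerN !hornerM hornerC.
exists q.
  split.
  - move=> i; rewrite coefB coefCM; apply: in_varsB; first by apply: in_varsM; [apply: W0|apply: Wp].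
    rewrite /t -scalerAl coefZ coefXnM; apply: in_varsM; first exact: Wp.
    by case: ifP => _; [apply: in_vars0|apply: W0].
  - by rewrite Eq; apply: (idealB hP); apply: (idealMl hP).
  - rewrite [X in (_ < X)%N](esym (prednK p_gt0)) ltnS; apply/leq_sizeP => i le_i.
    rewrite coefB coefCM /t -scalerAl coefZ coefXnM ltnNge.
    have -> /= : (size p - size p0 <= i)%N by lia.
    have [->|ne] := eqVneq i (size p).-1.
      rewrite (_ : ((size p).-1 - (size p - size p0))%N = (size p0).-1); last by lia.
      by rewrite -!lead_coefE mulrC subrr.
    have le_pi : (size p <= i)%N by rewrite -(prednK p_gt0) ltn_neqAle eq_sym ne.
    have le_p0i : (size p0 <= i - (size p - size p0))%N by lia.
    by rewrite !nth_default ?mulr0 ?subrr.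
rewrite Eq D_D D_N !D_M => H; apply: (primeMK hP nP0).
apply: (idealDK hP (idealMl hP (D b (lead_coef p0)) Pp)).
rewrite -[X in P X](subrK (D b t.[mvar s] * p0.[mvar s] + t.[mvar s] * D b p0.[mvar s])).
by apply: (idealD hP) => //; apply: (idealD hP); apply: (idealMl hP).
Qed.

(** This is the extension of a derivation to a simple field extension, with [r] as the cleared
    denominator. *)
Lemma extend_derivation : exists b,
  (exists2 r, ~ P r & forall v, W v -> b v = r * a v) /\
  forall f, in_vars (fun v => W v \/ v = s) f -> P f -> P (D b f).
Proof.
(* If every relation has its leading coefficient in [P], then [s] is transcendental over [W] modulo
   [P] and any value at [s] will do. Otherwise a shortest bad relation [p0] acts as minimal
   polynomial. *)
have [Pbad|Ptriv] := classic (exists p, [/\ coefs p, P p.[mvar s] & ~ P (lead_coef p)]); last first.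
  exists a; split; first by exists 1 => [|v _]; rewrite ?mul1r //; case: hP.
  move=> f /in_vars_poly[p Wp ->]; have [n] := ubnP (size p).
  elim: n => // n IH in p Wp *; rewrite ltnS => le_n Pp.
  have [->|nz] := eqVneq p 0; first by rewrite horner0 D_0; apply: ideal0.
  have Pl : P (lead_coef p) by apply: NNPP => H; apply: Ptriv; exists p.
  have [q [Wq Pq lt_q]] := step_down aW Wp Pl Pp nz.
  by apply; apply: IH => //; apply: leq_trans lt_q _.
have [p0 [W0 P0 nP0] min0] := exists_min (fun p : {poly A} => size p) Pbad.
have {}min0 q : coefs q -> P q.[mvar s] -> (size q < size p0)%N -> P (lead_coef q).
  by move=> Wq Pq lt_q; apply: NNPP => nPq; have := min0 q (And3 Wq Pq nPq); rewrite leqNgt lt_q.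
pose sg := p0^`().[mvar s].
have sz0 : (1 < size p0)%N.
  rewrite ltnNge; apply/negP => le1; apply: nP0.
  by move: P0; rewrite (size1_polyC le1) hornerC lead_coefC.
have Wd : coefs p0^`().
  move=> i; rewrite coef_deriv -mulr_natr -mconst_nat.
  by apply: in_varsM; [apply: W0|apply: in_varsC].
(* The derivative of [p0] is shorter than [p0], so with [sg] in [P] its leading coefficient would
   lie in [P]; but that is a positive integer multiple of [lead_coef p0]. *)
have nPsg : ~ P sg.
  move=> Psg; have top : p0^`()`_(size p0).-2 = lead_coef p0 * (size p0).-2.+1%:R.
    by rewrite coef_deriv lead_coefE mulr_natr; congr (p0`_ _ *+ _); lia.
  have nPtop : ~ P p0^`()`_(size p0).-2.
    by rewrite top; apply: (primeM hP) => //; apply: ideal_natr.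
  have lt_d : (size p0^`() < size p0)%N by apply: lt_size_deriv; rewrite -size_poly_gt0; lia.
  have szd : (size p0^`()).-1 = (size p0).-2.
    suff : ((size p0).-2 < size p0^`())%N by lia.
    rewrite ltnNge; apply/negP => le_d; apply: nPtop.
    by rewrite nth_default //; apply: ideal0.
  by apply: nPtop; rewrite -szd -lead_coefE; apply: min0.
(* [D a'] acts on the coefficients of [p0] only. The value of [b] at [s] is the solution of
   [sg * D a' p0 + b s * sg = 0], which is [D b p0 = 0]. *)
pose a' v := if v == s then 0 else a v.
pose b v := if v == s then - D a' p0.[mvar s] else sg * a v.
have bE v : W v -> b v = sg * a v.
  by rewrite /b; case: eqP => // ->.
exists b; split; first by exists sg.
have bW f : in_vars W f -> P f -> P (D b f).
  move=> fW Pf; rewrite (@eq_D _ _ _ b (fun v => sg * a v)) => [|v /fW /bE //].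
  by rewrite D_scale; apply: (idealMl hP); apply: aW.
have D0 : D b p0.[mvar s] = 0.
  rewrite (D_split s) (@eq_D _ _ _ _ (fun v => sg * a' v)) => [|v _]; last first.
    by rewrite /b /a'; case: eqP; rewrite ?mulr0.
  by rewrite D_scale /b eqxx (pd_horner Ws W0) -/sg; ring.
move=> f /in_vars_poly[p Wp ->]; have [n] := ubnP (size p).
elim: n => // n IH in p Wp *; rewrite ltnS => le_n Pp.
have [->|nz] := eqVneq p 0; first by rewrite horner0 D_0; apply: ideal0.
have [lt_p|le_p] := ltnP (size p) (size p0).
  have [q [Wq Pq lt_q]] := step_down bW Wp (min0 _ Wp Pp lt_p) Pp nz.
  by apply; apply: IH => //; apply: leq_trans lt_q _.
have PD0 : P (D b p0.[mvar s]) by rewrite D0; apply: ideal0.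
have [|q [Wq Pq lt_q]] := step_div PD0 W0 nP0 P0 Wp Pp le_p; first by rewrite size_poly_gt0.
by apply; apply: IH => //; apply: leq_trans lt_q _.
Qed.

End Extension.

(** Differentiation by [x] respects [P] on polynomials in [X], which meet [P] only in [0]. It is
    extended over [S] one indeterminate at a time, each extension scaling the old values by an
    element outside [P]. *)
Lemma indep_derivation X x (S : seq I) : indep X -> X x -> exists a,
  [/\ ~ P (a x), forall v, X v -> v <> x -> a v = 0 &
      forall f, in_vars (fun v => X v \/ v \in S) f -> P f -> P (D a f)].
Proof.
move=> Xind Xx; elim: S => [|s S [a [ax aX aP]]].
  exists (fun v => (v == x)%:R); split.
  - by rewrite eqxx; case: hP.
  - by move=> v _ /eqP/negPf ->.
  - move=> f fX Pf; rewrite (Xind f) ?D_0; [exact: ideal0| |by []].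
    by apply: in_varsS fX => v [].
have [Ws|nWs] := classic (X s \/ s \in S).
  exists a; split=> // f fW; apply: aP; apply: in_varsS fW => v [?|]; first by left.
  by rewrite in_cons => /orP[/eqP ->|?]; [|right].
have [b [[r nPr bE] bP]] := extend_derivation nWs aP.
exists b; split=> [|v Xv vx|f fW].
- by rewrite bE; [apply: (primeM hP)|left].
- by rewrite bE ?aX ?mulr0 //; left.
- apply: bP; apply: in_varsS fW => v [?|]; first by left; left.
  by rewrite in_cons => /orP[/eqP ->|?]; [right|left; right].
Qed.

Lemma indep_not_cl X x : indep X -> X x -> ~ cl (fun v => X v /\ v <> x) x.
Proof.
move=> Xind Xx [T PT HT].
have [a [ax aX aP]] := indep_derivation (flatten [seq enum_fset (mvars f) | f <- T]) Xind Xx.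
apply: ax; apply: HT => [f fT|v [Xv vx]]; last by rewrite aX //; apply: ideal0.
apply: aP (PT f fT) => v vf; right; apply/flattenP.
by exists (enum_fset (mvars f)) => //; apply: map_f.
Qed.

(** A nonzero relation of least [tdeg] is taken: its partial derivatives at occurring variables are
    nonzero in characteristic zero and of smaller [tdeg], hence outside [P]. *)
Lemma dep_polynomial X : ~ indep X -> exists f,
  [/\ in_vars X f, P f, exists v, v \in mvars f & forall v, v \in mvars f -> ~ P (pd v f)].
Proof.
move=> nX; have : exists f, [/\ in_vars X f, P f & f <> 0].
  by apply: NNPP => H; apply: nX => f fX Pf; apply: NNPP => nz; apply: H; exists f.
move=> /(exists_min tdeg)[f [fX Pf /eqP nz] min]; exists f; split=> //.
  apply: NNPP => H; have [c Ef] : exists c, f = mconst c.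
    by apply: mvars_eq0; apply/fsetP => v; rewrite in_fset0; apply/negP => ?; apply: H; exists v.
  by move: nz; rewrite Ef (ideal_mconst (c := c)) -?Ef // mconst0 eqxx.
move=> v vf Ppd; have := min (pd v f).
rewrite leqNgt (tdeg_pd v nz); suff H : [/\ in_vars X (pd v f), P (pd v f) & pd v f <> 0] by move/(_ H).
by split=> //; [apply: in_vars_pd|apply/eqP/pd_neq0].
Qed.

Lemma dep_cl X : ~ indep X -> exists2 x, X x & cl (fun v => X v /\ v <> x) x.
Proof.
move=> /dep_polynomial[f [fX Pf [v vf] sep]]; exists v; first exact: fX.
by apply: (cl_step Pf (sep v vf)) => u uf /eqP uv; apply: cl_sub; split=> //; apply: fX.
Qed.

Lemma indepS X Y : (forall v, X v -> Y v) -> indep Y -> indep X.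
Proof. by move=> sXY Yind f fX; apply: Yind; apply: in_varsS fX. Qed.

(** Exchange inequality. With derivations [a j] dual to the elements of [X], a shorter [Y] would
    allow a combination that vanishes modulo [P] on [Y], hence on [X], and yet not at some element
    of [X]. *)
Lemma indep_size_le (X Y : seq I) : uniq X -> indep (fun v => v \in X) ->
  (forall x, x \in X -> cl (fun v => v \in Y) x) -> (size X <= size Y)%N.
Proof.
move=> uX Xind /cl_seq[T PT HT]; rewrite leqNgt; apply/negP => lt_YX.
case: X => [//|x0 X'] in uX Xind HT lt_YX *; set X := x0 :: X' in uX Xind HT lt_YX.
have ex_a (j : 'I_(size X)) : exists a, [/\ ~ P (a (nth x0 X j)),
    forall v, v \in X -> v <> nth x0 X j -> a v = 0 & forall f, f \in T -> P (D a f)].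
  have Xj : nth x0 X j \in X by apply: mem_nth.
  have [a [ax aX aP]] := indep_derivation (flatten [seq enum_fset (mvars f) | f <- T]) Xind Xj.
  exists a; split=> // f fT; apply: aP (PT f fT) => v vf; right; apply/flattenP.
  by exists (enum_fset (mvars f)) => //; apply: map_f.
have [a aH] := fin_all_exists ex_a.
have [c [[j cj] c_eq]] := linear_dependence hP (fun j i => a j (nth x0 Y i)) lt_YX.
pose b v := \sum_j c j * a j v.
have /HT : forall f, f \in T -> P (D b f).
  move=> f fT; rewrite /b D_sum; apply: (ideal_sum hP) => u _ _; rewrite D_scale.
  by apply: (idealMl hP); case: (aH u) => _ _; apply.
have bY y : y \in Y -> P (b y).
  by move=> Yy; rewrite -(nth_index x0 Yy); apply: c_eq; rewrite index_mem.
move=> /(_ bY _ (mem_nth x0 (ltn_ord j))).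
rewrite /b (bigD1 j) //= big1 ?addr0 => [|i ij].
  by move=> /(primeMK hP cj); case: (aH j).
case: (aH i) => _ -> //; rewrite ?mulr0 ?mem_nth //.
by move/eqP; rewrite nth_uniq // eq_sym => /eqP/val_inj/eqP; apply/negP.
Qed.

(** A dependent [Y] would contain some [y] in the closure of the others, and a list shorter than [X]
    would still generate [X]. *)
Lemma indep_of_size (X Y : seq I) : uniq X -> indep (fun v => v \in X) ->
  (forall x, x \in X -> cl (fun v => v \in Y) x) -> (size Y <= size X)%N ->
  indep (fun v => v \in Y).
Proof.
move=> uX Xind clX le_YX; apply: NNPP => /dep_cl[y Yy cly].
have : (size X <= size (rem y Y))%N.
  apply: indep_size_le => // x /clX; apply: cl_trans => u uY.
  have sub z : z \in Y /\ z <> y -> z \in rem y Y.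
    by rewrite (perm_mem (perm_to_rem Yy)) in_cons => -[/orP[/eqP ->|]].
  have [->|/eqP uy] := eqVneq u y; first exact: clS cly.
  by apply: cl_sub; apply: sub.
have Y_gt0 : (0 < size Y)%N by rewrite lt0n size_eq0; apply: contraTneq Yy => ->.
by move=> /(leq_trans le_YX); rewrite size_rem // -ltnS prednK // ltnn.
Qed.

End Closure.

Arguments cl {k I A} P Y v.
Arguments indep {k I A} P X.

(** * Prolongation of differential relations *)

Section Differential.

Context {k : fieldType} {l : nat} {A : monomialRing k (dvar l)}.
Context {d : k -> k} (hd : is_derivation d).
Implicit Types (f g : A) (u v w : dvar l) (W : dvar l -> Prop).

Definition vnext v : dvar l := (v.1, v.2.+1).
Definition delta f : A := der d (fun v => mvar (vnext v)) f.

Lemma deltaC c : delta (mconst c) = mconst (d c).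
Proof. exact: (derC hd). Qed.
Lemma deltaD f g : delta (f + g) = delta f + delta g.
Proof. exact: (derD hd). Qed.
Lemma deltaXM v f : delta (mvar v * f) = mvar (vnext v) * f + mvar v * delta f.
Proof. by rewrite /delta (derM hd) (derX hd). Qed.

Lemma vnext_inj : injective vnext.
Proof. by move=> [i r] [j s] [-> ->]. Qed.

Lemma in_vars_delta W f : in_vars W f ->
  in_vars (fun v => W v \/ exists2 u, W u & v = vnext u) (delta f).
Proof.
move: f; apply: in_vars_ind => [c|f1 f2 IH1 IH2|v f1 Wv f1W IH].
- by rewrite deltaC; apply: in_varsC.
- by rewrite deltaD; apply: in_varsD.
- rewrite deltaXM; apply: in_varsD; apply: in_varsM => //; last by apply: in_varsX; left.
    by apply: in_varsX; right; exists v.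
  by apply: in_varsS f1W => u; left.
Qed.

(** In [delta f] the derivative [vnext v] enters only through the term [pd v f * mvar (vnext v)], so
    the separant persists under differentiation. *)
Lemma pd_delta v f : vnext v \notin mvars f -> pd (vnext v) (delta f) = pd v f.
Proof.
move=> vf; have fW : in_vars (fun u => u != vnext v) f.
  by move=> u; apply: contraTneq => ->.
suff [] : pd (vnext v) (delta f) = pd v f /\ pd (vnext v) f = 0 by [].
move: f fW {vf}; apply: in_vars_ind => [c|f1 f2 [e1 z1] [e2 z2]|u f1 uv _ [e1 z1]].
- by rewrite deltaC !pd_C.
- by rewrite deltaD !pd_D e1 e2 z1 z2 addr0.
- rewrite deltaXM pd_D !pd_M !pd_X e1 z1 (negPf uv) (inj_eq vnext_inj) /=; split; ring.
Qed.

Lemma mvars_iter_delta s f u : u \in mvars (iter s delta f) ->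
  exists2 w, w \in mvars f & w.1 = u.1 /\ (w.2 <= u.2 <= w.2 + s)%N.
Proof.
elim: s u => [|s IH] u; first by move=> uf; exists u => //; rewrite addn0 leqnn.
case/(in_vars_delta (in_vars_self (f := _))) => [/IH|[v /IH]] [w wf [w1 w2]].
  by exists w => //; split=> //; lia.
by move=> ->; exists w => //; split=> //; rewrite addnS ltnS; case/andP: w2 => /leqW -> ->.
Qed.

Lemma pd_iter_delta s f i p : (forall r, (i, r) \in mvars f -> (r <= p)%N) ->
  pd (i, p + s)%N (iter s delta f) = pd (i, p) f.
Proof.
move=> le_p; elim: s => [|s IH]; first by rewrite addn0.
rewrite addnS -[(i, _)]/(vnext (i, p + s)%N) iterS pd_delta //.
apply/negP => /mvars_iter_delta[[j r] rf /= [Ej lt_r]]; subst j.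
by have := le_p r rf; lia.
Qed.

Context (char0 : [pchar k] =i pred0).
Context {P : A -> Prop} (hP : prime_ideal P) (Pdelta : forall f, P f -> P (delta f)).

Lemma ideal_iter_delta s f : P f -> P (iter s delta f).
Proof. by move=> Pf; elim: s => //= s; apply: Pdelta. Qed.

(* The polynomials [G i] may contain the leading derivative of [G t]; hence at
   each order the prolongation of [G t] is used before the others. *)
Lemma prolongation (K : {set 'I_l}) (p e : 'I_l -> nat) (t : 'I_l) (G : 'I_l -> A) :
  (forall i, i \in K -> P (G i) /\ ~ P (pd (i, p i) (G i))) ->
  (forall (i j : 'I_l) (r : nat), i \in K -> (j, r) \in mvars (G i) -> j \in K ->
     (r < p j + ((j == i) || (j == t)))%N) ->
  (forall (i j : 'I_l) (r : nat), i \in K -> (j, r) \in mvars (G i) -> j \notin K -> (r <= e j)%N) ->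
  forall s i r, i \in K -> (r <= p i + s)%N ->
    cl P (fun v => v.2 < (if v.1 \in K then p v.1 else e v.1 + s.+1))%N (i, r).
Proof.
move=> PG GK Ge s; have [n] := ubnP s; elim: n => // n IH in s *; rewrite ltnS => le_sn.
pose Z v := is_true (v.2 < (if v.1 \in K then p v.1 else e v.1 + s.+1))%N.
(* Orders below [p i] belong to [Z]; the others come from the induction at [s.-1], whose generating
   set is contained in [Z]. *)
have lower i r : i \in K -> (r < p i + s)%N -> cl P Z (i, r).
  move=> iK lt_r; have [lt_rp|le_pr] := ltnP r (p i).
    by apply: cl_sub; rewrite /Z /= iK.
  have s_gt0 : (0 < s)%N by lia.
  apply: clS (IH s.-1 _ i r iK _); [|lia|lia].
  by move=> v; rewrite /Z; case: ifP => //; lia.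
(* The [s]-th derivative of [G i] has at [(i, p i + s)] the separant of [G i]. Its other variables
   are in [Z] or covered by [lower], except possibly [(t, p t + s)]. *)
have top i : i \in K -> (i = t \/ cl P Z (t, p t + s)%N \/ t \notin K) -> cl P Z (i, p i + s)%N.
  move=> iK tP; have [PGi nPGi] := PG i iK.
  have le_p r : (i, r) \in mvars (G i) -> (r <= p i)%N.
    by move=> rG; have := GK i i r iK rG iK; rewrite eqxx /=; lia.
  apply: (cl_step hP (ideal_iter_delta s PGi)); first by rewrite pd_iter_delta.
  move=> [j r] /mvars_iter_delta[[j0 r0] /= rG [Ej le_r]] ne; subst j0.
  have [jK|njK] := boolP (j \in K); last first.
    apply: cl_sub; rewrite /Z /= (negPf njK).
    by have := Ge i j r0 iK rG njK; lia.
  have := GK i j r0 iK rG jK; have [Eji|nji] := eqVneq j i.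
    subst j; rewrite /= => lt_r0; apply: lower => //.
    by have : r != (p i + s)%N by [apply: contraNneq ne => ->]; lia.
  have [Ejt|njt] := eqVneq j t; rewrite /= => lt_r0; last by apply: lower => //; lia.
  subst j; have [->|ner] := eqVneq r (p t + s)%N; last by apply: lower => //; lia.
  case: tP => [Eit|[//|]]; first by rewrite Eit eqxx in nji.
  by rewrite jK.
move=> i r iK; rewrite leq_eqVlt => /orP[/eqP ->|]; last exact: lower.
apply: (top) => //; right; have [tK|] := boolP (t \in K); last by right.
by left; apply: top => //; left.
Qed.

End Differential.

(** * Rankings and principal derivatives *)

Section Ranking.

Lemma exists_extremum (T : eqType) (R : rel T) (Q : T -> Prop) (s : seq T) :
  reflexive R -> transitive R -> total R -> (exists2 x, x \in s & Q x) ->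
  exists2 x, x \in s /\ Q x & forall y, y \in s -> Q y -> R x y.
Proof.
move=> Rxx Rtr Rtot; elim: s => [|z s IH]; first by case.
have [/IH[x [xs Qx] xmin] _|nQ [x]] := classic (exists2 x, x \in s & Q x).
  have [Qz|nQz] := classic (Q z); last first.
    exists x; first by rewrite in_cons xs orbT.
    by move=> y; rewrite in_cons => /orP[/eqP -> //|]; apply: xmin.
  case/orP: (Rtot x z) => [Rxz|Rzx].
    exists x; first by rewrite in_cons xs orbT.
    by move=> y; rewrite in_cons => /orP[/eqP -> //|]; apply: xmin.
  exists z; first by rewrite mem_head.
  move=> y; rewrite in_cons => /orP[/eqP -> //|ys Qy].
  exact: Rtr Rzx (xmin _ ys Qy).
rewrite in_cons => /orP[/eqP ->|xs Qx]; last by case: nQ; exists x.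
move=> Qz; exists z; first by rewrite mem_head.
move=> y; rewrite in_cons => /orP[/eqP -> //|ys Qy]; by case: nQ; exists y.
Qed.

Context {l : nat} {rk : rel (dvar l)} (hrk : is_ranking rk).
Implicit Types (u v w : dvar l).

Lemma rk_refl : reflexive rk.
Proof. by case: hrk => [[]]. Qed.
Lemma rk_anti u v : rk u v -> rk v u -> u = v.
Proof. by case: hrk => [[_]] + _ _ _ _; apply. Qed.
Lemma rk_trans u v w : rk u v -> rk v w -> rk u w.
Proof. by case: hrk => _ + _ _ _; apply. Qed.
Lemma rk_total : total rk.
Proof. by case: hrk. Qed.
Lemma rk_shift v s : rk v (v.1, v.2 + s)%N.
Proof. by case: hrk. Qed.
Lemma rk_shift2 u v s : rk v u -> rk (v.1, v.2 + s)%N (u.1, u.2 + s)%N.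
Proof. by case: hrk => _ _ _ _; apply. Qed.
Lemma rk_next u v : rk v u -> rk (vnext v) (vnext u).
Proof. by move=> /(rk_shift2 1); rewrite !addn1. Qed.
Lemma rk_leq (i : 'I_l) r s : (r <= s)%N -> rk (i, r) (i, s).
Proof. by move=> le_rs; have := rk_shift (i, r) (s - r); rewrite /= subnKC. Qed.
Lemma rk_leqE (i : 'I_l) r s : rk (i, r) (i, s) = (r <= s)%N.
Proof.
apply/idP/idP => [H|]; last exact: rk_leq.
case: (leqP r s) => // lt_sr; have [E] := rk_anti H (rk_leq i (ltnW lt_sr)).
by rewrite E ltnn in lt_sr.
Qed.

Lemma rk_max (B : {fset dvar l}) : (exists v, v \in B) ->
  exists2 v, v \in B & forall u, u \in B -> rk u v.
Proof.
move=> [v vB].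
have [||||x [xB _] xmax] := @exists_extremum _ (fun u w => rk w u) (fun=> True) (enum_fset B).
- exact: rk_refl.
- by move=> y x z xy yz; apply: rk_trans xy.
- by move=> x y; apply: rk_total.
- by exists v.
by exists x => // u uB; apply: xmax.
Qed.

(** Within one indeterminate the ranking is the order, so the least orders leave at most [l]
    derivatives to compare. *)
Lemma rk_wf (Q : dvar l -> Prop) : (exists v, Q v) ->
  exists2 v, Q v & forall u, Q u -> rk v u.
Proof.
move=> [[i0 r0] Q0].
have /fin_all_exists[r rP] (i : 'I_l) : exists r, forall s, Q (i, s) -> Q (i, r) /\ (r <= s)%N.
  have [Qi|nQ] := classic (exists s, Q (i, s)); last by exists 0%N => s Qs; case: nQ; exists s.
  have [r Qr rmin] := exists_min id Qi.
  by exists r => s /rmin.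
have [||||[i ri] [/mapP[j _ [-> ->]] Qj] jmin] :=
  @exists_extremum _ rk Q [seq (i, r i) | i <- enum 'I_l].
- exact: rk_refl.
- by move=> y x z; apply: rk_trans.
- exact: rk_total.
- exists (i0, r i0); first by apply: map_f; rewrite mem_enum.
  by case: (rP _ _ Q0).
exists (j, r j) => // -[i' s] Qs; have [Qr le_r] := rP _ _ Qs.
apply: (@rk_trans _ (i', r i')); last exact: rk_leq.
by apply: jmin => //; apply: map_f; rewrite mem_enum.
Qed.

End Ranking.

(** * Finite sets of derivatives given by an order bound for each indeterminate *)

Section Stairs.

Context {l : nat}.
Implicit Types (b : 'I_l -> nat).

Definition stairs b : seq (dvar l) := [seq (i, r) | i <- enum 'I_l, r <- iota 0 (b i)].

Lemma mem_stairs b (v : dvar l) : (v \in stairs b) = (v.2 < b v.1)%N.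
Proof.
apply/allpairsPdep/idP => [[i [r [_]]]|lt_v].
  by rewrite mem_iota add0n => /= lt_r ->.
by exists v.1, v.2; rewrite mem_enum mem_iota -surjective_pairing.
Qed.

Lemma stairs_uniq b : uniq (stairs b).
Proof.
apply: allpairs_uniq_dep; first exact: enum_uniq.
  by move=> i _; apply: iota_uniq.
by move=> [i r] [j s] _ _ /= [-> ->].
Qed.

Lemma size_stairs b : size (stairs b) = (\sum_i b i)%N.
Proof.
rewrite size_allpairs_dep sumnE big_map big_enum /=.
by apply: eq_bigr => i _; rewrite size_iota.
Qed.

Lemma sum_if (K : {set 'I_l}) b N :
  (\sum_i (if i \in K then b i else N) = \sum_(i in K) b i + #|~: K| * N)%N.
Proof.
rewrite (bigID (fun i => i \in K)) /=; congr (_ + _)%N.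
  by apply: eq_bigr => i ->.
rewrite (eq_bigr (fun=> N)) => [|i /negPf -> //].
by rewrite sum_nat_const; congr (_ * N)%N; apply: eq_card => i; rewrite !inE.
Qed.

End Stairs.

(** * Principal and parametric derivatives, and the relations at the corners *)

Section Parametric.

Context {k : fieldType} {l : nat} {A : monomialRing k (dvar l)}.
Context {d : k -> k} (hd : is_derivation d) (char0 : [pchar k] =i pred0).
Context {P : A -> Prop} (hP : prime_ideal P) (Pdelta : forall f, P f -> P (delta (d := d) f)).
Context {rk : rel (dvar l)} (hrk : is_ranking rk).
Implicit Types (f g : A) (u v w : dvar l).

Definition principal v := exists f, [/\ P f, in_vars (fun u => rk u v) f & ~ P (pd v f)].

(** The derivative of a relation with leader [v] has leader [vnext v] and the same separant. *)
Lemma principal_next v : principal v -> principal (vnext v).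
Proof.
move=> [f [Pf fv nPf]]; exists (delta (d := d) f); split.
- exact: Pdelta.
- apply: in_varsS (in_vars_delta hd fv) => u [uv|[w wv ->]]; last exact: (rk_next hrk).
  by apply: (rk_trans hrk uv); have := rk_shift hrk v 1; rewrite addn1.
rewrite pd_delta //; apply/negP => /fv H.
by have := rk_leqE hrk v.1 v.2.+1 v.2; rewrite -surjective_pairing ltnn H.
Qed.

Lemma principal_shift i r s : (r <= s)%N -> principal (i, r) -> principal (i, s).
Proof.
move=> /subnKC <-; elim: (s - r)%N => [|n IH] H; first by rewrite addn0.
by rewrite addnS; apply: (principal_next (v := (i, r + n)%N)); apply: IH.
Qed.

(** The leader of a least relation has its separant outside [P] and so would be principal. *)
Lemma parametric_indep : indep P (fun v => ~ principal v).
Proof.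
apply: NNPP => /(dep_polynomial char0 hP)[f [fX Pf /(rk_max hrk)[v vf vmax] sep]].
by case: (fX v vf); exists f; split=> //; apply: sep.
Qed.

(** Well-founded induction on the ranking: a principal [v] is algebraic over the lower variables of
    its relation. *)
Lemma cl_parametric v : cl P (fun u => ~ principal u /\ rk u v) v.
Proof.
apply: NNPP => nv.
have [{nv}v nv vmin] := @rk_wf _ _ hrk (fun v => ~ cl P (fun u => ~ principal u /\ rk u v) v)
  (ex_intro _ v nv).
apply: nv; have [[f [Pf fv nPf]]|nL] := classic (principal v); last first.
  by apply: cl_sub; split=> //; apply: (rk_refl hrk).
apply: (cl_step hP Pf nPf) => u /fv uv nuv; apply: NNPP => nu.
have [vu|nvu] := classic (rk v u).
  by rewrite (rk_anti hrk uv vu) eqxx in nuv.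
apply: nvu; apply: vmin => H; apply: nu; apply: clS H => w [nw wu].
by split=> //; apply: (rk_trans hrk wu).
Qed.

Lemma principal_corners : exists (J : {set 'I_l}) (rho : 'I_l -> nat),
  forall v, principal v <-> v.1 \in J /\ (rho v.1 <= v.2)%N.
Proof.
have /fin_all_exists[c cP] (i : 'I_l) : exists c : bool * nat,
    forall r, principal (i, r) <-> c.1 /\ (c.2 <= r)%N.
  have [Li|nL] := classic (exists r, principal (i, r)); last first.
    by exists (false, 0%N) => r; split=> [?|[]//]; case: nL; exists r.
  have [r0 Lr0 rmin] := exists_min id Li.
  by exists (true, r0) => r; split=> [/rmin //|[_ /principal_shift]]; apply.
exists [set i | (c i).1], (fun i => (c i).2) => -[i r] /=.
by rewrite inE.
Qed.

Context {J : {set 'I_l}} {rho : 'I_l -> nat}.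
Hypothesis cornersP : forall v, principal v <-> v.1 \in J /\ (rho v.1 <= v.2)%N.

(** The corner depends on the parametric derivatives below it, and a least relation is taken. It
    must contain the corner, since a relation among parametric derivatives alone is [0]. *)
Lemma corner_polynomial i : i \in J -> exists F,
  [/\ P F, in_vars (fun u => (~ principal u /\ rk u (i, rho i)) \/ u = (i, rho i)) F,
      (i, rho i) \in mvars F & forall u, u \in mvars F -> ~ P (pd u F)].
Proof.
move=> iJ; set v := (i, rho i).
have Lv : principal v by apply/cornersP.
pose X u := (~ principal u /\ rk u v) \/ u = v.
have nX : ~ indep P X.
  move=> /(indep_not_cl char0 hP)/(_ (or_intror erefl : X v)); apply.
  apply: clS (cl_parametric v) => u [nu uv]; split; first by left.
  by move=> E; rewrite E in nu.
have [F [FX PF [u uF] sep]] := dep_polynomial char0 hP nX.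
exists F; split=> //; apply: NNPP => vF.
apply: (sep u uF); rewrite (parametric_indep _ PF) ?(pd_C _ 0) //; last first.
  move=> w wF; case: (FX w wF) => [[] //|E].
  by case: vF; rewrite -E.
by rewrite -mconst0 pd_C; apply: (ideal0 hP).
Qed.

Lemma indep_stairs b : (forall i, i \in J -> (b i <= rho i)%N) ->
  indep P (fun v => v \in stairs b).
Proof.
move=> le_b; apply: indepS parametric_indep => v; rewrite mem_stairs => lt_v.
by move=> /cornersP[/le_b]; lia.
Qed.

(** For an orderly ranking, derivatives of order below [N] are algebraic over parametric ones of
    order below [N]. *)
Lemma orderly_size_le (X : seq (dvar l)) N : is_orderly rk ->
  uniq X -> indep P (fun v => v \in X) -> (forall v, v \in X -> (v.2 < N)%N) ->
  (size X <= \sum_(i in J) rho i + #|~: J| * N)%N.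
Proof.
move=> ord uX Xind ltN; rewrite -sum_if -size_stairs.
apply: (indep_size_le char0 hP uX Xind) => v /ltN vN; apply: clS (cl_parametric v) => u [nu uv].
rewrite mem_stairs; case: ifP => uJ.
  by rewrite ltnNge; apply/negP => le_u; apply/nu/cornersP.
apply: leq_ltn_trans vN; rewrite leqNgt; apply/negP => /ord[vu ne].
by apply: ne; apply: (rk_anti hrk).
Qed.

Lemma corner_family : exists F : 'I_l -> A, forall i, i \in J ->
  [/\ P (F i), (i, rho i) \in mvars (F i), forall u, u \in mvars (F i) -> ~ P (pd u (F i)),
      in_vars (fun u => (~ principal u /\ rk u (i, rho i)) \/ u = (i, rho i)) (F i) &
      forall u, u \in mvars (F i) -> u.1 \in J -> (u.2 < rho u.1)%N \/ u = (i, rho i)].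
Proof.
suff /fin_all_exists[F FP] i : exists F, i \in J -> 
  [/\ P F, (i, rho i) \in mvars F, forall u, u \in mvars F -> ~ P (pd u F),
      in_vars (fun u => (~ principal u /\ rk u (i, rho i)) \/ u = (i, rho i)) F &
      forall u, u \in mvars F -> u.1 \in J -> (u.2 < rho u.1)%N \/ u = (i, rho i)].
  by exists F.
have [iJ|] := boolP (i \in J); last by exists 0.
have [F [PF FX vF sep]] := corner_polynomial iJ; exists F => _; split=> // u uF uJ.
case: (FX u uF) => [[nu _]|]; last by right.
by left; rewrite ltnNge; apply/negP => ?; apply/nu/cornersP.
Qed.

End Parametric.

(** * The order bound by counting *)

Section OrderBound.

Context {k : fieldType} {l : nat} {A : monomialRing k (dvar l)}.
Context {d : k -> k} (hd : is_derivation d) (char0 : [pchar k] =i pred0).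
Context {P : A -> Prop} (hP : prime_ideal P) (Pdelta : forall f, P f -> P (delta (d := d) f)).
Context {rk : rel (dvar l)} (hrk : is_ranking rk).
Context {J : {set 'I_l}} {rho : 'I_l -> nat}.
Hypothesis cornersP : forall v, principal (P := P) (rk := rk) v <-> v.1 \in J /\ (rho v.1 <= v.2)%N.
Context {F : 'I_l -> A}.
Hypothesis PF : forall i, i \in J -> P (F i).
Hypothesis sepF : forall i u, i \in J -> u \in mvars (F i) -> ~ P (pd u (F i)).
Hypothesis cornerF : forall i, i \in J -> (i, rho i) \in mvars (F i).
Hypothesis reducedF : forall i u, i \in J -> u \in mvars (F i) -> u.1 \in J ->
  (u.2 < rho u.1)%N \/ u = (i, rho i).
Context {rk' : rel (dvar l)} (hrk' : is_ranking rk') (ord' : is_orderly rk').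
Context {J' : {set 'I_l}} {rho' : 'I_l -> nat}.
Hypothesis cornersP' : forall v, principal (P := P) (rk := rk') v <-> v.1 \in J' /\ (rho' v.1 <= v.2)%N.

Let h := (\sum_(i in J') rho' i)%N.

Let leq_sum_in (K : {set 'I_l}) (b : 'I_l -> nat) i : i \in K -> (b i <= \sum_(j in K) b j)%N.
Proof. by move=> iK; rewrite (bigD1 i) //= leq_addr. Qed.

Let E := (\max_i \max_(v <- mvars (F i)) v.2)%N.

Let leq_E i u : u \in mvars (F i) -> (u.2 <= E)%N.
Proof.
move=> uF; apply: leq_trans (leq_bigmax i).
exact: (@leq_bigmax_seq _ _ xpredT (fun v => v.2) u).
Qed.

(** A substitute for the orderly count under an arbitrary ranking: [N] differentiations of the [F i]
    reach order at most [E + N], so the bound has the same slope in [N] and only a worse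
    constant. *)
Let size_le (X : seq (dvar l)) N : uniq X -> indep P (fun v => v \in X) ->
  (forall v, v \in X -> (v.2 < N)%N) ->
  (size X <= \sum_(i in J) rho i + #|~: J| * (E + N.+1))%N.
Proof.
move=> uX Xind ltN; rewrite -sum_if -size_stairs.
apply: (indep_size_le char0 hP uX Xind) => -[i r] /ltN /= rN.
have [iJ|niJ] := boolP (i \in J); last first.
  by apply: cl_sub; rewrite mem_stairs /= (negPf niJ); lia.
have H : cl P (fun v => v.2 < if v.1 \in J then rho v.1 else E + N.+1)%N (i, r).
  have prol := prolongation hd hP Pdelta (K := J) (p := rho) (e := fun=> E) (t := i) (G := F).
  apply: (prol _ _ _ N) => // [j jJ|j m s jJ mF mJ|j m s jJ mF mJ|].
  - by split; [apply: PF|apply: sepF => //; apply: cornerF].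
  - by case: (reducedF jJ mF mJ) => [/= |[-> ->]]; rewrite ?eqxx; lia.
  - exact: (leq_E mF).
  - lia.
by apply: clS H => v; rewrite mem_stairs.
Qed.

Let leq_slope a b c c' n : (forall N, n <= N -> a + c * N <= b + c' * N)%N -> (c <= c')%N.
Proof.
move=> H; rewrite leqNgt; apply/negP => lt_c.
have := H (n + b.+1)%N (leq_addr _ _).
have : (c'.+1 * (n + b.+1) <= c * (n + b.+1))%N by rewrite leq_mul2r lt_c orbT.
rewrite mulSn; lia.
Qed.

(** [up] and [low] are affine inequalities in [N], so their slopes agree; with equal slopes [up]
    compares the constants. *)
Lemma parametric_count : #|~: J| = #|~: J'| /\ (\sum_(i in J) rho i <= h)%N.
Proof.
have up N : (\sum_(i in J) rho i <= N)%N ->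
    (\sum_(i in J) rho i + #|~: J| * N <= h + #|~: J'| * N)%N.
  move=> le_N; rewrite -sum_if -size_stairs.
  apply: (orderly_size_le char0 hP hrk' cornersP' ord') => [||v].
  - exact: stairs_uniq.
  - by apply: (indep_stairs char0 hP hrk cornersP) => i ->.
  - rewrite mem_stairs; case: ifP => // vJ /leq_trans; apply.
    exact: leq_trans (leq_sum_in rho vJ) le_N.
have low N : (h <= N)%N ->
    (h + #|~: J'| * N <= (\sum_(i in J) rho i + #|~: J| * E.+1) + #|~: J| * N)%N.
  move=> le_N; rewrite -addnA -mulnDr addSnnS /h -sum_if -size_stairs.
  apply: size_le => [||v].
  - exact: stairs_uniq.
  - by apply: (indep_stairs char0 hP hrk' cornersP') => i ->.
  - rewrite mem_stairs; case: ifP => // vJ /leq_trans; apply.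
    exact: leq_trans (leq_sum_in rho' vJ) le_N.
have c_eq : #|~: J| = #|~: J'|.
  by apply/eqP; rewrite eqn_leq (leq_slope up) (leq_slope low).
by split=> //; have := up _ (leqnn _); rewrite c_eq leq_add2r.
Qed.

Lemma corner_polynomial_order j u : j \in J -> u \in mvars (F j) -> (u.2 <= h)%N.
Proof.
have [cardJ le_sum] := parametric_count.
have rho_le i : i \in J -> (rho i <= h)%N.
  by move=> iJ; apply: leq_trans le_sum; apply: leq_sum_in.
move=> jJ uF; have [uJ|] := boolP (u.1 \in J).
  case: (reducedF jJ uF uJ) => [/ltnW /leq_trans|->]; last exact: rho_le.
  by apply; apply: rho_le.
case: u uF => t r /= rF tJ; move: j jJ rF => j0 j0J rF.
pose Q (w : nat) := exists2 j, j \in J & (t, w) \in mvars (F j).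
have Qr : Q r by exists j0.
have leE w : Q w -> (w <= E)%N by case=> j _ /leq_E.
(* As the orders in question are at most [E], minimizing [E - w] gives the greatest order [w] of a
   derivative of [y_t] in the relations; it is attained in [F j]. *)
have [w Qw wmax] := exists_min (fun w => E - w)%N (ex_intro Q r Qr).
have {}wmax w' : Q w' -> (w' <= w)%N.
  by move=> Qw'; have := wmax _ Qw'; have := leE _ Qw'; have := leE _ Qw; lia.
apply: leq_trans (wmax _ Qr) _; case: Qw => j jJ wF.
have tj : (t == j) = false by apply: contraNF tJ => /eqP ->.
(* The exchange: [F j] is now read as a relation for [(t, w)], and [j] leaves the set. The relations
   contain [y_j] up to order [rho j], which explains [e j]. *)
pose K := t |: (J :\ j).
pose p i := if i == t then w else rho i.
pose G i := if i == t then F j else F i.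
pose e i := if i == j then rho j else E.
(* This makes [M] at least [w] and at least every [rho i] with [i] in [J], so that all bounds [p m]
   fit below order [M.+1]. *)
pose M := (w + h)%N.
have inK i : (i \in K) = (i == t) || (i != j) && (i \in J) by rewrite !inE.
have prol := prolongation hd hP Pdelta (K := K) (p := p) (e := e) (t := t) (G := G).
have {}prol m r0 : m \in K -> (r0 <= p m + M)%N ->
    cl P (fun v => v.2 < if v.1 \in K then p v.1 else e v.1 + M.+1)%N (m, r0).
  apply: (prol _ _ _ M) => {m r0} [i|i m s|i m s]; rewrite inK.
  - rewrite /G /p; case: eqP => [-> _|_ /= /andP[_ iJ]].
      by split; [apply: PF|apply: sepF].
    by split; [apply: PF|apply: sepF => //; apply: cornerF].
  - rewrite /G /p inK; case: (eqVneq m t) => [->|nmt] /=.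
      by rewrite orbT addn1 ltnS => iK sF _; apply: wmax; move: iK sF;
        case: eqP => [_ _ ?|_ /andP[_ iJ] ?]; [exists j|exists i].
    move=> iK sF /andP[nmj mJ]; rewrite orbF; case: (eqVneq i t) iK sF => [_ _|_ /= /andP[_ iJ]] sF.
      by case: (reducedF jJ sF mJ) => [/= /leq_trans|[Emj _]]; [apply; apply: leq_addr|rewrite Emj eqxx in nmj].
    by case: (reducedF iJ sF mJ) => [/= /leq_trans|[-> ->]]; [apply; apply: leq_addr|rewrite eqxx addn1].
  - rewrite /G /e inK => iK sF; rewrite negb_or negb_and negbK => /andP[_].
    case: eqP => [Emj _|_ _].
      rewrite {m}Emj in sF *; move: iK sF; case: eqP => [_ _|_ /= /andP[_ iJ]] sF.
        by case: (reducedF jJ sF jJ) => [/= /ltnW|[->]].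
      by case: (reducedF iJ sF jJ) => [/= /ltnW|[-> ->]].
    by move: sF; case: ifP => _ /leq_E.
(* The parametric set [bX] and the exchanged set [bY] differ only at [t] and [j], where [M.+1]
   orders move from [t] to [j]; hence they have equal size. *)
pose bX m := if m \in J then rho m else if m == t then (w + M.+1)%N else (E + M.+1)%N.
pose bY m := if m \in K then p m else (e m + M.+1)%N.
have sumXY : (\sum_m bX m = \sum_m bY m)%N.
  have split2 (b : 'I_l -> nat) :
      (\sum_m b m = b j + (b t + \sum_(m | (m != j) && (m != t)) b m))%N.
    by rewrite (bigD1 j) //= (bigD1 t) //= tj.
  rewrite (split2 bX) (split2 bY).
  have -> : bX j = rho j by rewrite /bX jJ.
  have -> : bX t = (w + M.+1)%N by rewrite /bX (negPf tJ) eqxx.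
  have -> : bY j = (rho j + M.+1)%N by rewrite /bY inK eqxx eq_sym tj /= /e eqxx.
  have -> : bY t = w by rewrite /bY inK eqxx /p eqxx.
  rewrite (eq_bigr bY) => [|m /andP[mj mt]]; first by rewrite !addnA; congr (_ + _)%N; lia.
  by rewrite /bX /bY inK /p /e mj (negPf mt) (negPf mj).
(* The prolonged relations put the [t]-column of [bX] into the closure of [bY]; all else in [bX]
   lies in [bY] already. *)
have Yind : indep P (fun v => v \in stairs bY).
  apply: (indep_of_size char0 hP (stairs_uniq bX)).
  - by apply: (indep_stairs char0 hP hrk cornersP) => m mJ; rewrite /bX mJ.
  - move=> [m s]; rewrite mem_stairs /=.
    have sub : (s < bY m)%N -> cl P (fun v => v \in stairs bY) (m, s).
      by move=> lt_s; apply: cl_sub; rewrite mem_stairs.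
    have [->|mt] := eqVneq m t.
      rewrite /bX (negPf tJ) eqxx addnS ltnS => le_s.
      have H : cl P (fun v => v.2 < if v.1 \in K then p v.1 else e v.1 + M.+1)%N (t, s).
        by apply: prol; rewrite ?inK /p ?eqxx.
      by apply: clS H => v; rewrite mem_stairs.
    move=> lt_s; apply: sub; move: lt_s; rewrite /bX /bY inK /p /e (negPf mt) /=.
    by have [->|mj] := eqVneq m j; rewrite ?jJ /=; [move/leq_trans; apply; apply: leq_addr|case: ifP].
  - by rewrite !size_stairs sumXY.
(* Cutting [bY] at order [M] allows the orderly count. Since [K] and [J'] have complements of equal
   size, what remains is that the sum of [p] over [K], which includes [p t = w], is at most [h]. *)
pose b m := if m \in K then p m else M.+1.
have p_le m : m \in K -> (p m <= M)%N.
  rewrite inK /p /M; case: eqP => [_ _|_ /= /andP[_ /rho_le]]; first exact: leq_addr.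
  by move=> /leq_trans; apply; apply: leq_addl.
have : (size (stairs b) <= h + #|~: J'| * M.+1)%N.
  apply: (orderly_size_le char0 hP hrk' cornersP' ord' (stairs_uniq b)).
  - apply: indepS Yind => v; rewrite !mem_stairs /b /bY; case: ifP => // _.
    by move=> /leq_trans; apply; apply: leq_addl.
  - move=> v; rewrite mem_stairs /b; case: ifP => // vK /leq_trans; apply.
    exact: leq_trans (p_le _ vK) _.
rewrite size_stairs sum_if.
have -> : #|~: K| = #|~: J'|.
  rewrite -cardJ; have cardK : #|K| = #|J|.
    by rewrite /K cardsU1 !inE (negPf tJ) andbF (cardsD1 j J) jJ.
  by apply: (@addnI #|K|); rewrite cardsC cardK cardsC.
rewrite leq_add2r; apply: leq_trans.
have tK : t \in K by rewrite inK eqxx.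
by have := leq_sum_in p tK; rewrite {1}/p eqxx.
Qed.

End OrderBound.

(** * Characteristic sets *)

Section DifferentialPolynomials.

Context {k : fieldType} {l : nat}.

Lemma dpoly_coefP (f g : dpoly k l) : (forall m, f@_m = g@_m) -> f = g.
Proof. by move/malgP. Qed.

Lemma dpoly_coefU c (m m' : cmonom (dvar l)) :
  (<< c *g m >> : dpoly k l)@_m' = if m == m' then c else 0.
Proof. by rewrite mcoeffU; case: (m == m'). Qed.

Lemma dpoly_suppE (f : dpoly k l) m : (m \in msupp f) = (f@_m != 0).
Proof. by rewrite mcoeff_neq0. Qed.

Lemma dpoly_monoM c c' (m m' : cmonom (dvar l)) :
  << c *g m >> * << c' *g m' >> = << c * c' *g mulcm m m' >> :> dpoly k l.
Proof. by rewrite malgM_def fgmulUU. Qed.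

Definition dpolyRing : monomialRing k (dvar l) :=
  @MonomialRing k (dvar l) (dpoly k l) (fun c m => << c *g m >>) (fun f m => f@_m)
    (fun f => msupp f) dpoly_coefP (fun f g m => mcoeffD m f g) dpoly_coefU dpoly_suppE
    (fun f => monalgE f) dpoly_monoM erefl.

(** Stated over the abstract ring, so that the comparison with [dder] goes term by term. *)
Lemma delta_expand (A : monomialRing k (dvar l)) (d : k -> k) (f : A) :
  delta (d := d) f = \sum_(m <- supp f) (mono A (d (mcoef f m)) m + mconst (mcoef f m) *
    \sum_(v <- finsupp m) mono A (m v)%:R (mulcm (divcm m (ucm v)) (ucm (v.1, v.2.+1)))).
Proof.
apply: eq_bigr => m _; congr (_ + _ * _); apply: eq_bigr => v _.
by rewrite -mconst_nat /mvar monoM mul_mconst !mulr1.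
Qed.

Lemma dder_delta (d : k -> k) (f : dpoly k l) : dder d f = delta (A := dpolyRing) (d := d) f.
Proof.
rewrite delta_expand; apply: eq_bigr => m _; congr (_ + _).
exact: (esym (mul_malgC _ _)).
Qed.

Lemma dvars_mvars (f : dpoly k l) : dvars f = mvars (A := dpolyRing) f.
Proof. by []. Qed.

Lemma ddeg_mdegin u (f : dpoly k l) : ddeg u f = mdegin (A := dpolyRing) u f.
Proof. by []. Qed.

Lemma prime_diff_ideal_prime (d : k -> k) (P : dpoly k l -> Prop) :
  is_prime_diff_ideal d P -> prime_ideal (R := dpolyRing) P.
Proof. by case=> -[P0 [PD PM]] Pp _ P1; split. Qed.

Lemma prime_diff_ideal_delta (d : k -> k) (P : dpoly k l -> Prop) :
  is_prime_diff_ideal d P -> forall f : dpolyRing, P f -> P (delta (d := d) f).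
Proof. by case=> _ _ Pd _ f /Pd; rewrite dder_delta. Qed.

End DifferentialPolynomials.

(** * Leaders, reduction and comparison of ranks *)

Section Ranks.

Context {k : fieldType} {l : nat} {rk : rel (dvar l)} (hrk : is_ranking rk).
Implicit Types (f g : dpoly k l) (u v : dvar l).

Lemma leader_uniq f u v : is_leader rk f u -> is_leader rk f v -> u = v.
Proof. by move=> [uf umax] [vf vmax]; apply: (rk_anti hrk); [apply: vmax|apply: umax]. Qed.

Lemma leader_exists f : ~ is_const f -> exists u, is_leader rk f u.
Proof.
move=> nc; have [|u uf umax] := rk_max hrk (B := dvars f); last by exists u.
apply: NNPP => H; apply: nc; apply/fsetP => v; rewrite in_fset0.
by apply/negP => vf; apply: H; exists v.
Qed.

Lemma ddeg_gt0 u f : u \in dvars f -> (0 < ddeg u f)%N.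
Proof. by rewrite lt0n ddeg_mdegin mdegin_eq0 negbK. Qed.

Lemma ddeg_eq0 u f : u \notin dvars f -> ddeg u f = 0%N.
Proof. by rewrite dvars_mvars -mdegin_eq0 => /eqP. Qed.

Lemma reduced_leader f g u : is_leader rk g u ->
  is_reduced rk f g <-> ((forall s, (0 < s)%N -> (u.1, u.2 + s)%N \notin dvars f) /\
    (ddeg u f < ddeg u g)%N).
Proof. by move=> gu; split=> [/(_ _ gu) //|H v gv]; rewrite -(leader_uniq gu gv). Qed.

Lemma reduced_eqrank f g g' : poly_eqrank rk g g' -> is_reduced rk f g -> is_reduced rk f g'.
Proof.
move=> [u [gu g'u E]] /(reduced_leader _ gu) H; apply/(reduced_leader _ g'u).
by rewrite -E.
Qed.

Lemma dvars_pd u v f : v \in dvars (pd (A := dpolyRing) u f : dpoly k l) -> v \in dvars f.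
Proof. exact: (mvars_pd (A := dpolyRing)). Qed.

Lemma ddeg_pd u v f : (ddeg v (pd (A := dpolyRing) u f : dpoly k l) <= ddeg v f)%N.
Proof. exact: (mdegin_pd (A := dpolyRing)). Qed.

Lemma reduced_pd u f g : is_reduced rk f g ->
  is_reduced rk (pd (A := dpolyRing) u f : dpoly k l) g.
Proof.
move=> fg v gv; have [fv lt_f] := fg v gv; split=> [s s_gt0|].
  by apply: (contra _ (fv s s_gt0)); apply: dvars_pd.
exact: leq_ltn_trans (ddeg_pd _ _ _) lt_f.
Qed.

Lemma rank_trichotomy f g : ~ is_const f -> ~ is_const g ->
  [\/ poly_lt rk f g, poly_lt rk g f | poly_eqrank rk f g].
Proof.
move=> /leader_exists[u fu] /leader_exists[v gv].
have [E|/eqP ne] := eqVneq u v; last first.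
  case/orP: (rk_total hrk u v) => uv.
    by apply: Or31; exists u, v; split=> //; left.
  by apply: Or32; exists v, u; split=> //; left; split=> // E; apply: ne.
subst v; case: (ltngtP (ddeg u f) (ddeg u g)) => c.
- by apply: Or31; exists u, u; split=> //; right.
- by apply: Or32; exists u, u; split=> //; right.
- by apply: Or33; exists u.
Qed.

Lemma eqrank_sym f g : poly_eqrank rk f g -> poly_eqrank rk g f.
Proof. by move=> [u [? ? E]]; exists u. Qed.

(** Neither set is lower than the other, which excludes a first difference in rank and, after that,
    a difference in length. *)
Lemma char_set_eqrank (P : dpoly k l -> Prop) C C' : is_char_set rk P C -> is_char_set rk P C' ->
  size C = size C' /\ forall j, (j < size C)%N -> poly_eqrank rk (nth 0 C j) (nth 0 C' j).
Proof.
move=> [autoC PC minC] [autoC' PC' minC'].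
have first i : (forall j, (j < i)%N -> poly_eqrank rk (nth 0 C j) (nth 0 C' j)) ->
    (i < size C)%N -> (i < size C')%N -> poly_eqrank rk (nth 0 C i) (nth 0 C' i).
  move=> eqs iC iC'; case: (@rank_trichotomy (nth 0 C i) (nth 0 C' i)) => //.
  - by case: autoC => + _ _; apply; apply: mem_nth.
  - by case: autoC' => + _ _; apply; apply: mem_nth.
  - by move=> lt_i; case: (minC' C autoC PC); left; exists i.
  - move=> lt_i; case: (minC C' autoC' PC'); left; exists i; split=> // j /eqs.
    exact: eqrank_sym.
have eqs n : (n <= size C)%N -> (n <= size C')%N ->
    forall j, (j < n)%N -> poly_eqrank rk (nth 0 C j) (nth 0 C' j).
  elim: n => // n IH nC nC' j; rewrite ltnS leq_eqVlt => /orP[/eqP ->|].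
    by apply: first => //; apply: IH; apply: ltnW.
  by apply: IH; apply: ltnW.
case: (ltngtP (size C) (size C')) => [lt|lt|E].
- case: (minC C' autoC' PC'); right; split=> // j jC; apply: eqrank_sym.
  by apply: (eqs (size C)) => //; apply: ltnW.
- case: (minC' C autoC PC); right; split=> // j jC.
  by apply: (eqs (size C')) => //; apply: ltnW.
- by split=> // j jC; apply: (eqs (size C)); rewrite -?E.
Qed.

End Ranks.

(** * Construction of a characteristic set from minimal elements *)

Section CharacteristicSet.

Context {k : fieldType} {l : nat} {d : k -> k} {P : dpoly k l -> Prop}.
Context (hd : is_derivation d) (char0 : [pchar k] =i pred0).
Context (hP : is_prime_diff_ideal d P).
Context {rk : rel (dvar l)} (hrk : is_ranking rk).
Implicit Types (f g : dpoly k l) (u v : dvar l).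

Local Notation A := (@dpolyRing k l).
Let hP' : prime_ideal (R := A) P := prime_diff_ideal_prime hP.
Let Pdelta := prime_diff_ideal_delta hP.

Local Notation principal := (principal (A := A) (P := P) (rk := rk)).

Context {J : {set 'I_l}} {rho : 'I_l -> nat}.
Hypothesis cornersP : forall v, principal v <-> v.1 \in J /\ (rho v.1 <= v.2)%N.
Context {F : 'I_l -> A}.
Hypothesis PF : forall i, i \in J -> P (F i).
Hypothesis cornerF : forall i, i \in J -> (i, rho i) \in mvars (F i).
Hypothesis sepF : forall i, i \in J -> forall u, u \in mvars (F i) -> ~ P (pd u (F i)).
Hypothesis belowF : forall i, i \in J ->
  in_vars (fun u => (~ principal u /\ rk u (i, rho i)) \/ u = (i, rho i)) (F i).
Context (v0 : dvar l).

Definition corners : seq (dvar l) := sort rk [seq (i, rho i) | i <- enum J].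
Local Notation V := (nth v0 corners).
Local Notation n := (size corners).

Lemma mem_corners v : (v \in corners) = (v.1 \in J) && (v.2 == rho v.1).
Proof.
rewrite mem_sort; apply/mapP/andP => [[i iJ ->]|[vJ /eqP E]].
  by rewrite -mem_enum.
by exists v.1; rewrite ?mem_enum // -E -surjective_pairing.
Qed.

Lemma corners_uniq : uniq corners.
Proof. by rewrite sort_uniq map_inj_uniq ?enum_uniq // => i j []. Qed.

Lemma corners_leq i j : (i < j)%N -> (j < n)%N -> rk (V i) (V j).
Proof.
have tr : transitive rk by move=> y x z; apply: (rk_trans hrk).
move=> ij jn; apply: (sorted_ltn_nth tr v0 (sort_sorted (rk_total hrk) _)) => //.
by rewrite inE; apply: ltn_trans jn.
Qed.

Lemma corners_neq i j : (i < j)%N -> (j < n)%N -> V i <> V j.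
Proof.
move=> ij jn /eqP; rewrite nth_uniq ?corners_uniq //; last exact: ltn_trans jn.
by rewrite ltn_eqF.
Qed.

Lemma corners_lt_index i j u : (i < n)%N -> (j < n)%N -> rk (V j) u -> rk u (V i) -> u <> V i ->
  (j < i)%N.
Proof.
move=> lt_i lt_j ju ui ne; rewrite ltnNge; apply/negP => le_ij; apply: ne.
apply: (rk_anti hrk ui); apply: (rk_trans hrk _ ju).
move: le_ij; rewrite leq_eqVlt => /orP[/eqP ->|ij]; first exact: (rk_refl hrk).
exact: corners_leq.
Qed.

Lemma corner_nth i : (i < n)%N -> (V i).1 \in J /\ V i = ((V i).1, rho (V i).1).
Proof.
move=> /(mem_nth v0); rewrite mem_corners => /andP[? /eqP E]; split=> //.
by rewrite -E -surjective_pairing.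
Qed.

Lemma principal_corner u : principal u ->
  exists2 j, (j < n)%N & V j = (u.1, rho u.1) /\ (rho u.1 <= u.2)%N.
Proof.
move=> /cornersP[uJ le_u]; have uV : (u.1, rho u.1) \in corners.
  by rewrite mem_corners /= uJ eqxx.
by exists (index (u.1, rho u.1) corners); rewrite ?index_mem // nth_index.
Qed.

Lemma corner_shift i s : (i < n)%N -> principal ((V i).1, (V i).2 + s)%N.
Proof. by move=> /corner_nth[iJ ->]; apply/cornersP; split=> //=; apply: leq_addr. Qed.

(** Reducedness is required against earlier elements only; against later ones it follows from the
    order of the leaders. *)
Definition candidate (S : seq (dpoly k l)) i g :=
  [/\ P g, is_leader rk g (V i) & forall j, (j < i)%N -> is_reduced rk g (nth 0 S j)].

Definition minimal_candidate S i f := [/\ candidate S i f,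
  forall g, candidate S i g -> (ddeg (V i) f <= ddeg (V i) g)%N &
  forall g, candidate S i g -> ddeg (V i) g = ddeg (V i) f -> (tdeg (A := A) f <= tdeg (A := A) g)%N].

(** The only principal derivative in the corner relation is its own corner, whereas all derivatives
    of an earlier leader are principal. *)
Lemma corner_candidate S i : (i < n)%N -> (forall j, (j < i)%N -> is_leader rk (nth 0 S j) (V j)) ->
  candidate S i (F (V i).1).
Proof.
move=> lt_i leadS; have [iJ Vi] := corner_nth lt_i.
split; first exact: PF.
  split; first by rewrite Vi; apply: cornerF.
  by move=> u /(belowF iJ); rewrite -Vi => -[[]|->] //; apply: (rk_refl hrk).
move=> j ji; apply/(reduced_leader hrk _ (leadS j ji)).
have lt_j := ltn_trans ji lt_i; have ne := corners_neq ji lt_i.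
have absent s : ((V j).1, (V j).2 + s)%N \notin dvars (F (V i).1 : dpoly k l).
  apply/negP => /(belowF iJ); rewrite -Vi => -[[nL _]|E].
    by apply: nL; apply: corner_shift.
  have [jJ Vj] := corner_nth lt_j; apply: ne; have E1 : (V j).1 = (V i).1 by rewrite -E.
  by rewrite Vj E1 -Vi.
split=> [s _|]; first exact: absent.
rewrite ddeg_eq0; first by case: (leadS j ji) => /ddeg_gt0.
by have := absent 0%N; rewrite addn0 -surjective_pairing.
Qed.

Lemma candidate_prefix S S' i g : (forall j, (j < i)%N -> nth 0 S j = nth 0 S' j) ->
  candidate S i g -> candidate S' i g.
Proof. by move=> E [? ? red]; split=> // j ji; rewrite -E //; apply: red. Qed.

Lemma minimal_candidate_prefix S S' i g : (forall j, (j < i)%N -> nth 0 S j = nth 0 S' j) ->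
  minimal_candidate S i g -> minimal_candidate S' i g.
Proof.
move=> E [cand mind mint].
have E' j : (j < i)%N -> nth 0 S' j = nth 0 S j by move=> /E.
split; first exact: candidate_prefix cand.
  by move=> f /(candidate_prefix E'); apply: mind.
by move=> f /(candidate_prefix E'); apply: mint.
Qed.

Lemma minimal_candidates_exist : exists S : seq (dpoly k l),
  size S = n /\ forall i, (i < n)%N -> minimal_candidate S i (nth 0 S i).
Proof.
suff H m : (m <= n)%N -> exists S : seq (dpoly k l),
    size S = m /\ forall i, (i < m)%N -> minimal_candidate S i (nth 0 S i).
  exact: H (leqnn _).
elim: m => [|m IH] lt_m; first by exists [::].
have [S [sS minS]] := IH (ltnW lt_m).
have : exists g, candidate S m g.
  exists (F (V m).1); apply: corner_candidate => // j /minS[[]] //.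
move=> /(exists_min (ddeg (V m)))[f0 c0 min0].
have [f [cf Ef] minf] := exists_min (tdeg (A := A))
  (ex_intro (fun g : dpoly k l => candidate S m g /\ ddeg (V m) g = ddeg (V m) f0) f0 (conj c0 erefl)).
exists (rcons S f); rewrite size_rcons sS; split=> // i; rewrite ltnS => le_i.
apply: (@minimal_candidate_prefix S) => [j ji|].
  by rewrite nth_rcons sS (leq_trans ji le_i).
rewrite nth_rcons sS; move: le_i; rewrite leq_eqVlt => /orP[/eqP ->|lt_im].
  rewrite ltnn eqxx; split=> // [g /min0|g cg Eg]; first by rewrite Ef.
  by apply: minf; split=> //; rewrite Eg.
by rewrite lt_im; apply: minS.
Qed.

Section Minimal.

Context {S : seq (dpoly k l)} (sizeS : size S = n).
Hypothesis minS : forall i, (i < n)%N -> minimal_candidate S i (nth 0 S i).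

Lemma leaderS i : (i < n)%N -> is_leader rk (nth 0 S i) (V i).
Proof. by case/minS => -[]. Qed.

Lemma ideal_const f : P f -> is_const f -> f = 0.
Proof.
move=> Pf /(mvars_eq0 (A := A))[c Ec]; move: Pf; rewrite Ec.
by move=> /(ideal_mconst hP') ->; exact: (mconst0 (A := A)).
Qed.

(** Only elements of [S] with leader at most that of [g] matter, and this weaker assumption is what
    a comparison at position [i] provides. The induction is on [tdeg]. *)
Lemma reduced_eq0 g : P g -> (forall u j, is_leader rk g u -> (j < n)%N -> rk (V j) u ->
  is_reduced rk g (nth 0 S j)) -> g = 0.
Proof.
have [m] := ubnP (tdeg (A := A) g); elim: m => // m IH in g *; rewrite ltnS => le_m Pg red.
apply: NNPP => nz; have nc : ~ is_const g by move=> /(ideal_const Pg).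
have [u gu] := leader_exists hrk nc; have [ug umax] := gu.
have [Lu|nLu] := classic (principal u).
  have [j lt_j [Vj le_u]] := principal_corner Lu.
  have ju : rk (V j) u by rewrite Vj [u in rk _ u]surjective_pairing; apply: (rk_leq hrk).
  have /(reduced_leader hrk _ (leaderS lt_j))[redg ltg] := red u j gu lt_j ju.
  (* A leader equal to the corner [V j] would make [g] a candidate of too small degree; a proper
     derivative of [V j] is excluded by reducedness. *)
  move: le_u; rewrite leq_eqVlt => /orP[/eqP E|lt_u].
    have Vu : V j = u by rewrite Vj E -surjective_pairing.
    have [_ mind _] := minS lt_j; move: ltg; rewrite ltnNge mind //.
    split=> //; first by rewrite Vu.
    move=> i ij; apply: red gu _ _; first exact: ltn_trans lt_j.
    by rewrite -Vu; apply: corners_leq.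
  have := redg (u.2 - rho u.1)%N; rewrite subn_gt0 lt_u Vj /= subnKC ?(ltnW lt_u) //.
  by rewrite -surjective_pairing ug => /(_ isT).
(* For a parametric leader the separant lies in [P] and inherits the hypotheses, so by induction it
   vanishes, contrary to characteristic zero. *)
have Ppd : P (pd (A := A) u g) by apply: NNPP => nP; apply: nLu; exists g.
have pd0 : pd (A := A) u g <> 0 by apply/eqP/(pd_neq0 char0).
apply: pd0; apply: IH => //.
  by apply: leq_trans le_m; apply: tdeg_pd; apply/eqP.
move=> u' j [u'g _] lt_j ju'; apply: reduced_pd; apply: (red u j gu lt_j).
by apply: (rk_trans hrk ju'); apply: umax; apply: dvars_pd u'g.
Qed.

Lemma mvars_above i j s : (i < j)%N -> (j < n)%N ->
  ((V j).1, (V j).2 + s)%N \notin dvars (nth 0 S i).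
Proof.
move=> ij lt_j; apply/negP => H; have [_ vmax] := leaderS (ltn_trans ij lt_j).
apply: (corners_neq ij lt_j); apply: (rk_anti hrk); first exact: corners_leq.
exact: (rk_trans hrk (rk_shift hrk (V j) s) (vmax _ H)).
Qed.

Lemma minimal_autoreduced : is_autoreduced rk S.
Proof.
split.
- move=> a /(nthP 0)[i]; rewrite sizeS => /leaderS[va _] <-.
  by move=> c; rewrite c in_fset0 in va.
- move=> i j; rewrite sizeS => lt_i lt_j ne.
  case: (ltngtP i j) => // ij; last by case: (minS lt_i) => -[_ _ red] _ _; apply: red.
  apply/(reduced_leader hrk _ (leaderS lt_j)); split=> [s _|]; first exact: mvars_above.
  rewrite ddeg_eq0; first by case: (leaderS lt_j) => /ddeg_gt0.
  by have := mvars_above 0 ij lt_j; rewrite addn0 -surjective_pairing.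
- move=> i j ij; rewrite sizeS => lt_j; exists (V i), (V j).
  split; [by apply: leaderS; apply: ltn_trans lt_j|exact: leaderS|left; split].
    exact: corners_neq.
  exact: corners_leq.
Qed.

Lemma minimal_char_set : is_char_set rk P S.
Proof.
split; first exact: minimal_autoreduced.
  by move=> c /(nthP 0)[i]; rewrite sizeS => /minS[[+ _ _] _ _] <-.
move=> B [ncB redB _] PB.
have ncB' j : (j < size B)%N -> ~ is_const (nth 0 B j) by move=> lt_j; apply/ncB/mem_nth.
have nz j : (j < size B)%N -> nth 0 B j <> 0.
  move=> /ncB' nc E; apply: nc; rewrite E; apply/fsetP => v; rewrite in_fset0.
  by apply/negP => /(in_vars0 (A := A) (fun=> False)).
have redBS i j : (i < size B)%N -> (j < i)%N -> poly_eqrank rk (nth 0 B j) (nth 0 S j) ->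
    is_reduced rk (nth 0 B i) (nth 0 S j).
  move=> lt_i ji eqr; apply: (reduced_eqrank hrk eqr); apply: redB => //.
    exact: ltn_trans lt_i.
  by move=> E; rewrite E ltnn in ji.
case=> [[i [iB iS eqr [u [v [Bu Sv lt_uv]]]]]|[ltS eqr]]; last first.
  (* The first surplus element of [B] would be reduced with respect to all of [S]. *)
  apply: (nz _ ltS); apply: reduced_eq0 => [|u j _ lt_j _]; first exact/PB/mem_nth.
  by rewrite -sizeS in lt_j; apply: redBS => //; apply: eqr.
rewrite sizeS in iS; have Ev := leader_uniq hrk (leaderS iS) Sv; subst v.
case: lt_uv => [[ne uV]|[Eu ltd]].
  (* With a leader below [V i], only corners before position [i] can lie below it, and there [B] and
     [S] agree in rank. *)
  apply: (nz _ iB); apply: reduced_eq0 => [|u' j Bu' lt_j ju']; first exact/PB/mem_nth.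
  have Eu := leader_uniq hrk Bu Bu'; subst u'.
  have ji := corners_lt_index iS lt_j ju' uV ne.
  by apply: redBS => //; apply: eqr.
subst u; have [_ mind _] := minS iS.
move: ltd; rewrite ltnNge mind //; split=> //; first exact/PB/mem_nth.
by move=> j ji; apply: redBS => //; apply: eqr.
Qed.

(** A proper derivative of a corner [V j] occurring in the element at [i] lies strictly between
    [V j] and [V i]; then [j < i], and reducedness forbids it. *)
Lemma minimal_vars_principal i (w : dvar l) : (i < n)%N -> w \in dvars (nth 0 S i) -> principal w ->
  w = (w.1, rho w.1).
Proof.
move=> lt_i wS Lw; have [j lt_j [Vj le_w]] := principal_corner Lw.
have [[_ [_ wmax] red] _ _] := minS lt_i.
have jw : rk (V j) w by rewrite Vj [w in rk _ w]surjective_pairing; apply: (rk_leq hrk).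
apply: NNPP => ne; have lt_w : (rho w.1 < w.2)%N.
  rewrite ltn_neqAle le_w andbT; apply: contra_notN ne => /eqP ->.
  exact: surjective_pairing.
have ji : (j < i)%N.
  apply: (corners_lt_index lt_i lt_j jw (wmax _ wS)) => E; apply: ne.
  by have [_] := corner_nth lt_i; rewrite -E.
have /(reduced_leader hrk _ (leaderS lt_j))[redg _] := red j ji.
have := redg (w.2 - rho w.1)%N; rewrite subn_gt0 lt_w Vj /= subnKC //.
by rewrite -surjective_pairing wS => /(_ isT).
Qed.

Lemma minimal_order h : (forall j u, j \in J -> u \in mvars (F j) -> (u.2 <= h)%N) ->
  forall i (w : dvar l), (i < n)%N -> w \in dvars (nth 0 S i) -> (w.2 <= h)%N.
Proof.
move=> ordF i w lt_i wS; rewrite leqNgt; apply/negP => lt_hw.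
have rho_le j : j \in J -> (rho j <= h)%N by move=> jJ; apply: (ordF j _ jJ (cornerF jJ)).
have nLw : ~ principal w.
  move=> Lw; have Ew := minimal_vars_principal lt_i wS Lw.
  by move: lt_hw; rewrite Ew /= ltnNge rho_le //; case/cornersP: Lw.
have [[PS [ViS Vimax] redS] mind mint] := minS lt_i.
pose Z u := ~ principal u /\ u <> w.
have nclw : ~ cl (A := A) P Z w.
  exact: (indep_not_cl char0 hP' (parametric_indep char0 hP' hrk)).
(* A principal variable is a corner here, and its relation has order at most [h], so it expresses
   the corner without [w]. *)
have clZ u : u \in dvars (nth 0 S i) -> u != w -> cl (A := A) P Z u.
  move=> uS /eqP uw; have [Lu|nLu] := classic (principal u); last by apply: cl_sub.
  have Eu := minimal_vars_principal lt_i uS Lu; have /cornersP[uJ _] := Lu.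
  have uF : u \in mvars (F u.1) by move: (cornerF uJ); rewrite -Eu.
  apply: (cl_step hP' (PF uJ) (sepF uJ uF)) => x xF /eqP xu; apply: cl_sub.
  have [[nLx _]|E] := belowF uJ xF; last by case: xu; rewrite [RHS]Eu.
  split; [exact: nLx | move=> E].
  by move: lt_hw; rewrite -E ltnNge (ordF _ _ uJ xF).
pose g : dpoly k l := pd (A := A) w (nth 0 S i).
have Pg : P g by apply: NNPP => nP; apply: nclw; apply: (cl_step hP' PS nP).
have g_nz : g <> 0 by apply/eqP; exact: (pd_neq0 (A := A) char0 wS).
have redg j : (j < i)%N -> is_reduced rk g (nth 0 S j).
  by move=> ji; apply: reduced_pd; apply: redS.
have lt_g : (tdeg (A := A) g < tdeg (A := A) (nth 0%R S i))%N.
  by apply: tdeg_pd; apply: contraTneq wS => ->; apply/negP => /(in_vars0 (A := A) (fun=> False)).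
(* If [V i] survives in [g], then [g] is a candidate of the same degree in [V i] and smaller [tdeg];
   otherwise its leader is below [V i] and reduction gives [g = 0]. *)
have [Vg|nVg] := boolP (V i \in dvars g).
  have candg : candidate S i g by split=> //; split=> // u /dvars_pd /Vimax.
  have Ed : ddeg (V i) g = ddeg (V i) (nth 0 S i).
    by apply/eqP; rewrite eqn_leq mind // andbT; apply: ddeg_pd.
  by have := mint g candg Ed; rewrite leqNgt lt_g.
apply: g_nz; apply: reduced_eq0 => // u j [ug _] lt_j ju; apply: redg.
apply: (corners_lt_index lt_i lt_j ju); first by apply: Vimax; apply: dvars_pd ug.
by move=> E; rewrite -E ug in nVg.
Qed.

(** All characteristic sets have the same leaders, here the corners, and an element has at least the
    order of its leader. *)
Lemma sum_corners_le C : is_char_set rk P C -> (\sum_(i in J) rho i <= aset_ord C)%N.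
Proof.
move=> charC; have [sC eqr] := char_set_eqrank hrk charC minimal_char_set.
have -> : (\sum_(i in J) rho i = \sum_(v <- corners) v.2)%N.
  rewrite (perm_big _ (permEl (perm_sort _ _))) big_map big_enum /=.
  by apply: eq_bigl => i.
rewrite /aset_ord (big_nth v0) (big_nth (0 : dpoly k l)) sC sizeS !big_nat.
apply: leq_sum => j /andP[_ lt_j].
have [|u [Cu Su _]] := eqr j; first by rewrite sC sizeS.
rewrite (leader_uniq hrk (leaderS lt_j) Su).
by case: Cu => uC _; apply: (@leq_bigmax_seq _ _ xpredT (fun v => v.2) u).
Qed.

End Minimal.

End CharacteristicSet.

(** * The case without indeterminates, and the final assembly *)

Lemma char_set_nil (k : fieldType) (l : nat) (P : dpoly k l -> Prop) (rk : rel (dvar l)) :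
  (dvar l -> False) -> is_char_set rk P [::].
Proof.
move=> noV; split=> //; move=> B [ncB _ _] _ [[i []] //|[ltB _]].
apply: (ncB (nth 0 B 0)); first exact: mem_nth.
by apply/fsetP => v; case: (noV v).
Qed.

Theorem mainTheorem3 (k : fieldType) (d : k -> k) (hd : is_derivation d)
    (hchar : [pchar k] =i pred0) (l : nat) (P : dpoly k l -> Prop)
    (hP : is_prime_diff_ideal d P) (h : nat) (hPh : has_order P h)
    (rk : rel (dvar l)) (hrk : is_ranking rk) :
  exists C : seq (dpoly k l), is_char_set rk P C /\
    forall c, c \in C -> forall t : 'I_l, (dord_in c t <= h)%N.
Proof.
(* A derivative [v0] is needed as the default of [nth] on the corners; without one, [l = 0] and the
   empty set serves. *)
have [[v0]|noV] := classic (inhabited (dvar l)); last first.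
  by exists [::]; split=> //; apply: char_set_nil => v; apply: noV.
case: hPh => rk' [hrk' ord' [C' [charC' <-]]].
have prime := prime_diff_ideal_prime hP; have Pdelta := prime_diff_ideal_delta hP.
have [J [rho cornersP]] := principal_corners hd Pdelta hrk.
have [J' [rho' cornersP']] := principal_corners hd Pdelta hrk'.
have [F FP] := corner_family hchar prime hrk cornersP.
have [F' FP'] := corner_family hchar prime hrk' cornersP'.
have PF i : i \in J -> P (F i) by case/FP.
have cornerF i : i \in J -> (i, rho i) \in mvars (F i) by case/FP.
have sepF i : i \in J -> forall u, u \in mvars (F i) -> ~ P (pd u (F i)) by case/FP.
have reducedF i u : i \in J -> u \in mvars (F i) -> u.1 \in J ->
    (u.2 < rho u.1)%N \/ u = (i, rho i).
  by case/FP => _ _ _ _; apply.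
have belowF i (iJ : i \in J) := let: And5 _ _ _ H _ := FP i iJ in H.
have PF' i : i \in J' -> P (F' i) by case/FP'.
have cornerF' i : i \in J' -> (i, rho' i) \in mvars (F' i) by case/FP'.
have belowF' i (iJ : i \in J') := let: And5 _ _ _ H _ := FP' i iJ in H.
(* The set for the orderly ranking serves only to bound the sum of [rho'] by the order of [P]. *)
have [S' [sizeS' minS']] := minimal_candidates_exist hrk' cornersP' PF' cornerF' belowF' v0.
have le_h := sum_corners_le hchar hP hrk' cornersP' sizeS' minS' charC'.
have [S [sizeS minS]] := minimal_candidates_exist hrk cornersP PF cornerF belowF v0.
exists S; split; first exact: (minimal_char_set hchar hP hrk cornersP sizeS minS).
move=> c /(nthP 0)[i]; rewrite sizeS => lt_i <- t.
apply/bigmax_leqP_seq => w wS _.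
apply: (minimal_order hchar hP hrk cornersP PF cornerF sepF belowF minS _ lt_i wS) => j u jJ uF.
apply: leq_trans le_h.
have sepF' i v (iJ : i \in J) := sepF i iJ v.
exact: (corner_polynomial_order hd hchar prime Pdelta hrk cornersP PF sepF' cornerF reducedF
  hrk' ord' cornersP' jJ uF).
Qed.
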